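(* Let $0<m\le l$, let $f_1,\dots,f_N\in\mathscr{S}_{m,l}$ be functions on $\mathbb{R}$, let $f=\frac1N\sum_{i=1}^N f_i$, and assume $\nabla f(0)=0$ and $\sigma_\infty^2=\frac1N\sum_{i=1}^N\|\nabla f_i(0)\|^2=0$. Let $A\in\mathbb{R}^{n\times n}$, $B\in\mathbb{R}^{n\times1}$, $C\in\mathbb{R}^{1\times n}$, $\rho\in(0,1]$ and $s\in\mathbb{N}_0$. If there exist a symmetric matrix $P\succ0$ of size $(n+s)\times(n+s)$ and parameters $\nu,\lambda_0,\dots,\lambda_s\in\mathbb{R}$ such that $$0\succ\begin{pmatrix}\mathcal{A}&\mathcal{B}_1\\ I&0\end{pmatrix}^\top\begin{pmatrix}P&0\\0&-P\end{pmatrix}\begin{pmatrix}\mathcal{A}&\mathcal{B}_1\\ I&0\end{pmatrix}+\begin{pmatrix}\mathcal{C}&\mathcal{D}_1\\0&1\end{pmatrix}^\top\begin{pmatrix}0&1\\1&0\end{pmatrix}\begin{pmatrix}\mathcal{C}&\mathcal{D}_1\\0&1\end{pmatrix},$$ $$0>\mathcal{B}_2^\top P\mathcal{B}_2-2\tilde b\nu,$$ $\lambda_1,\dots,\lambda_s\le0$ and $\nu=\sum_{j=0}^s\rho^{-j}\lambda_j\ge0$, then the query points $z_t$ of the algorithm $$x_{t+1}=Ax_t+Bw_t,\qquad z_t=Cx_t,\qquad w_t=\nabla f_{\mathscr{I}_t}(z_t)$$ satisfy, for all $t\in\mathbb{N}_0$, $$\lambda_{\min}(P)\,\mathbb{E}\big[\|z_t\|^2\big]\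 \le\ \|C\|^2\rho^{2t}\,\mathbb{E}\left[\begin{pmatrix}x_0\\0\end{pmatrix}^\top P\begin{pmatrix}x_0\\0\end{pmatrix}\right].$$
   Context: A differentiable $h:\mathbb{R}\to\mathbb{R}$ belongs to $\mathscr{S}_{m,l}$ if $z\mapsto h(z)-\frac m2\|z\|^2$ is convex and $z\mapsto h(z)-\frac l2\|z\|^2$ is concave. The decision variable is scalar ($d=1$). Mini-batches: $\mathscr{I}_0,\mathscr{I}_1,\dots$ are random mini-batches of size $b$ from $\{1,\dots,N\}$, independent across $t$, all sampled by one of two schemes: (i) uniform sampling with replacement ($\mathscr{I}_t$ is the multiset of $b$ i.i.d. uniform indices, counted with multiplicity); (ii) uniform sampling without replacement ($\mathscr{I}_t$ is uniformly distributed over the subsets of size $b$, with $b<N$). The mini-batch gradient is $\nabla f_{\mathscr{I}}(z)=\frac1b\sum_{i\in\mathscr{I}}\nabla f_i(z)$. The generalized batch size is $\tilde b=b$ in case (i) and $\tilde b=\frac{b(N-1)}{N-b}$ in case (ii). The initial state $x_0$ has finite second moment and is independent of the mini-batches (e.g. deterministic). Filter and combined system matrices: for $\lambda_0,\dots,\lambda_s$ let $$\left(\begin{array}{c|c}A_\psi&B_\psi\\\hline C_\psi&D_\psi\end{array}\right)=\left(\begin{array}{cccc|c}0&1&\cdots&0&0\\ \vdots&\ddots&\ddots&\vdots&\vdots\\0&\cdots&0&1&0\\0&\cdots&0&0&1\\\hline\lambda_s&\lambda_{s-1}&\cdots&\lambda_1&\lambda_0\end{array}\right),$$ with $A_\psi\in\mathbb{R}^{s\times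 s}$, $B_\psi\in\mathbb{R}^{s\times1}$, $C_\psi\in\mathbb{R}^{1\times s}$, $D_\psi=\lambda_0$, and $$\mathcal{A}=\begin{pmatrix}\rho^{-1}(A+BmC)&0\\(l-m)B_\psi C&A_\psi\end{pmatrix},\quad \mathcal{B}_1=\begin{pmatrix}\rho^{-1}B\\-B_\psi\end{pmatrix},\quad \mathcal{B}_2=\begin{pmatrix}\rho^{-1}B\\0\end{pmatrix},$$ $$\mathcal{C}=\begin{pmatrix}(l-m)D_\psi C&C_\psi\end{pmatrix},\quad \mathcal{D}_1=-D_\psi .$$ $\lambda_{\min}(P)$ is the smallest eigenvalue of $P$ and $\|C\|$ the Euclidean (operator) norm of $C$. *)

(* Defs.v *)
From HB Require Import structures.
From mathcomp Require Import all_boot all_order all_algebra finmap multiset.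
From mathcomp Require Import all_classical all_reals all_analysis.

Set Implicit Arguments.
Unset Strict Implicit.
Unset Printing Implicit Defensive.

Import Order.TTheory GRing.Theory Num.Theory.
Import numFieldNormedType.Exports.

Local Open Scope classical_set_scope.
Local Open Scope ring_scope.

Definition in_S (R : realType) (m l : R) (h : R -> R) : Prop :=
  [/\ forall z, derivable h z 1,
      convex_function setT (fun z : R^o => h z - m / 2 * `|z| ^+ 2) &
      (* concavity, as convexity of the opposite *)
      convex_function setT (fun z : R^o => - (h z - l / 2 * `|z| ^+ 2))].

Definition posdef (R : realType) (k : nat) (M : 'M[R]_k) : Prop :=
  M^T = M /\ forall v : 'cV[R]_k, v != 0 -> 0 < (v^T *m M *m v) 0 0.

Definition negdef (R : realType) (k : nat) (M : 'M[R]_k) : Prop :=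
  posdef (- M).

(* For symmetric [M] with [0 < k] the set below is finite and nonempty, so that
   the infimum is attained. *)
Definition lambda_min (R : realType) (k : nat) (M : 'M[R]_k) : R :=
  inf [set a | eigenvalue M a].

(* The norm [`|v|] that the library puts on matrices is the maximum norm. *)
Definition enorm (R : realType) (k : nat) (v : 'cV[R]_k) : R :=
  Num.sqrt (\sum_(i < k) v i 0 ^+ 2).

Section filter.
Variables (R : realType) (s : nat) (lam : 'I_s.+1 -> R).

Definition A_psi : 'M[R]_s := \matrix_(i, j) (j == i.+1 :> nat)%:R.

Definition B_psi : 'cV[R]_s := \col_i (i.+1 == s)%:R.

(* Entry [j] is [lam (s - j)]. *)
Definition C_psi : 'rV[R]_s :=
  \row_j lam (rev_ord (widen_ord (leqnSn s) j)).

Definition D_psi : 'M[R]_1 := (lam ord0)%:M.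

Variables (n : nat) (m l rho : R).
Variables (A : 'M[R]_n) (B : 'cV[R]_n) (C : 'rV[R]_n).

Definition calA : 'M[R]_(n + s) :=
  block_mx (rho^-1 *: (A + m *: (B *m C))) 0 ((l - m) *: (B_psi *m C)) A_psi.

Definition calB1 : 'cV[R]_(n + s) := col_mx (rho^-1 *: B) (- B_psi).

Definition calB2 : 'cV[R]_(n + s) := col_mx (rho^-1 *: B) 0.

Definition calC : 'rV[R]_(n + s) := row_mx ((l - m) *: (D_psi *m C)) C_psi.

Definition calD1 : 'M[R]_1 := - D_psi.

Definition lmi_mx (P : 'M[R]_(n + s)) : 'M[R]_((n + s) + 1) :=
  let F : 'M[R]_((n + s) + (n + s), (n + s) + 1) :=
    block_mx calA calB1 1%:M 0 in
  let G : 'M[R]_(1 + 1, (n + s) + 1) := block_mx calC calD1 0 1%:M in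
  F^T *m block_mx P 0 0 (- P) *m F + G^T *m block_mx 0 1%:M 1%:M 0 *m G.

End filter.

Section probability.
Context d (Omega : measurableType d) (R : realType) (Pr : probability Omega R).

Definition random_element (T : Type) (G : set_system T) (X : Omega -> T) :=
  forall U, G U -> measurable (X @^-1` U).

Definition sigma_of (T : Type) (G : set_system T) (X : Omega -> T) :
    set_system Omega := preimage_set_system setT X G.

(* Finite and countable types carry the discrete sigma-algebra. *)
Definition discrete (T : Type) : set_system T := setT.

Definition borel_cV (n : nat) : set_system 'cV[R]_n := <<s @open 'cV[R]_n >>.

Definition independent (F G : set_system Omega) : Prop :=
  forall E E', F E -> G E' -> Pr (E `&` E') = (Pr E * Pr E')%E.

Definition mutually_independent (K : choiceType) (F : K -> set_system Omega) :
    Prop :=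
  forall (J : {fset K}) (E : K -> set Omega),
    (forall k, k \in J -> F k (E k)) ->
    Pr (\bigcap_(k in [set` J]) E k) = (\prod_(k <- J) Pr (E k))%E.

Variables (N b : nat).

Definition uniform_with_replacement (I : Omega -> {mset 'I_N}%mset) : Prop :=
  exists idx : 'I_b -> Omega -> 'I_N,
  [/\ forall k, random_element (@discrete 'I_N) (idx k),
      mutually_independent (fun k => sigma_of (@discrete 'I_N) (idx k)),
      forall k i, Pr (idx k @^-1` [set i]) = (N%:R^-1)%:E &
      forall w, I w = seq_mset [seq idx k w | k <- enum 'I_b]].

Definition uniform_without_replacement (I : Omega -> {mset 'I_N}%mset) : Prop :=
  (b < N)%N /\
  exists S : Omega -> {set 'I_N},
  [/\ random_element (@discrete {set 'I_N}) S,
      forall D : {set 'I_N}, #|D| = b ->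
        Pr (S @^-1` [set D]) = ('C(N, b)%:R^-1)%:E &
      forall w, I w = seq_mset (enum (S w))].

End probability.

Arguments borel_cV : clear implicits.
Arguments discrete : clear implicits.

Variant scheme := WithReplacement | WithoutReplacement.

Definition sampled d (Omega : measurableType d) (R : realType)
    (Pr : probability Omega R) (sch : scheme) (N b : nat)
    (I : Omega -> {mset 'I_N}%mset) : Prop :=
  match sch with
  | WithReplacement => uniform_with_replacement Pr b I
  | WithoutReplacement => uniform_without_replacement Pr b I
  end.

Definition btilde (R : realType) (sch : scheme) (N b : nat) : R :=
  match sch with
  | WithReplacement => b%:R
  | WithoutReplacement => b%:R * (N%:R - 1) / (N%:R - b%:R)
  end.

(* The sum runs over the multiset [I], i.e. it counts multiplicities. *)
Definition batch_grad (R : realType) (N b : nat) (f : 'I_N -> R -> R)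
    (I : {mset 'I_N}%mset) (z : R) : R :=
  b%:R^-1 * \sum_(i <- I) derive1 (f i) z.

(* Main.v *)
Require Import Defs.
From HB Require Import structures.
From mathcomp Require Import all_boot all_order all_algebra finmap multiset.
From mathcomp Require Import all_classical all_reals all_analysis.
From mathcomp Require Import measurable_realfun ring lra.

Set Implicit Arguments.
Unset Strict Implicit.
Unset Printing Implicit Defensive.

Import Order.TTheory GRing.Theory Num.Theory.
Import numFieldNormedType.Exports.

Local Open Scope classical_set_scope.
Local Open Scope ring_scope.

(** The argument is a supermartingale argument with a dynamic multiplier of
O'Shea-Zames-Falb type.

Write [g] for the gradient of [f], [u = g(z) - m z] ([slope]) and
[q = l z - g(z)] ([coslope]).  Rescaling time by [rho^-t], the state of the
algorithm together with the last [s] values of [q], held in the shift register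
[filter_state], satisfies a linear recursion driven by [u] and by the sampling
error of the gradient ([joint_state_cons]).  The output of the filter is the
combination of present and past values of [q] with coefficients [lam]
([joint_output]).  For the quadratic form [lyapunov] of [P] the matrix
inequality thus says that, without sampling error, [lyapunov] decreases by at
least [2 u] times that output ([lmi_dissipation]).

Two facts make this supply large enough.  First, convexity and smoothness give a
nonnegative [storage] function [H] with
[u(z) (q(z) - q(y)) >= H(z) - H(y)] ([storage_supply]).  As [lam j <= 0] for
[j > 0], the terms with delayed [q] can be traded, up to a telescoping sum of
storages ([stored]), for undelayed ones, and what remains is [nu u q]
([supply_ge]).  Second, since every [f_i] has gradient zero at the origin,
[u q] dominates the variance of [i |-> f_i'(z)] ([variance_le_supply]): it is
the mean of the nonnegative products [u_i q_i] plus that variance.  A mini-batch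
divides the variance by the generalized batch size ([sampled_lawP]), so the
condition on [calB2] makes twice [nu u q] pay for the expected increase
of [lyapunov] caused by the sampling error.  Hence [lyapunov + stored] is a
supermartingale ([supermartingale_step]).

The batches take finitely many values, so all of this is a statement about
finite weighted sums over batch histories, valid for each fixed initial state
([mean_query_le]).  Randomness of the initial state enters only at the end: its
independence of the batches turns the expectation of a function of the history
and [x_0] into the expectation of such a weighted sum ([expectation_history]).
The eigenvalue [lambda_min P] enters through the Rayleigh bound
[lambda_min_le_bform], obtained without diagonalization. *)

(** * Tangent bounds and the storage function *)

Section function_class.
Context {R : realType}.
Implicit Types (m l y z : R) (F G : R -> R).

(** The difference quotients of [phi] at [z] in the direction [y - z] with step
in (0, 1] are at most [phi y - phi z] by convexity; let the step tend to 0. *)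
Lemma convex_tangent (phi : R -> R) z dphi y :
  convex_function setT (phi : R^o -> R^o) -> is_derive z (1 : R) phi dphi ->
  phi z + dphi * (y - z) <= phi y.
Proof.
move=> cvx dz; rewrite -lerBrDl.
have [dp <-] := dz.
have df : differentiable phi z by exact/derivable1_diffP.
have -> : 'D_1 phi z * (y - z) = 'D_(y - z) phi z.
  rewrite !deriveE// mulrC -[_ * _]/(_ *: _) -linearZ/=.
  by rewrite -[_ *: _]/(_ * _) mulr1.
have dv : derivable phi z (y - z) by exact: diff_derivable.
have dvr : h^-1 *: (phi (h *: (y - z) + z) - phi z) @[h --> 0^'+]
             --> 'D_(y - z) phi z.
  by apply: cvg_dnbhs_at_right; exact: dv.
apply: (cvgr_to_le dvr); near=> h.
have h0 : 0 < h by near: h; exact: nbhs_right_gt.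
have h1 : h <= 1 by near: h; exact: nbhs_right_le.
have h01 : (0 <= h <= 1)%R by rewrite ltW.
have /= := cvx (Itv01 (ltW h0) h1) y z (in_setT _) (in_setT _).
rewrite /= [X in phi X <= _](_ : _ = h *: (y - z) + z); last first.
  by rewrite /conv/= /unstable.onem /GRing.scale/=; ring.
rewrite convRE /unstable.onem/= => H.
by rewrite /GRing.scale/= ler_pdivrMl//; lra.
Unshelve. all: by end_near. Qed.

(** The class [S_{m,l}] seen through first-order information only: [F] lies above
the quadratics of curvature [m] and below those of curvature [l] tangent to it,
[G] playing the role of the derivative.  Unlike differentiability with a fixed
derivative, this passes to averages without any calculus. *)
Definition tangent_bounds m l F G := forall y z,
  F z - m / 2 * z ^+ 2 + (G z - m * z) * (y - z) <= F y - m / 2 * y ^+ 2 /\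
  F y - l / 2 * y ^+ 2 <= F z - l / 2 * z ^+ 2 + (G z - l * z) * (y - z).

Lemma in_S_tangent_bounds m l (h : R -> R) :
  in_S m l h -> tangent_bounds m l h (derive1 h).
Proof.
move=> [dh cvx ccv] y z.
have dhz : is_derive z (1 : R) h (derive1 h z).
  by rewrite derive1E; apply: DeriveDef => //; exact: dh.
have dq c : is_derive z (1 : R) (fun z : R => c / 2 * `|z| ^+ 2) (c * z).
  under [X in is_derive _ _ X]eq_fun do rewrite real_normK ?num_real//.
  by apply: is_derive_eq; rewrite /GRing.scale/=; field.
have sq (v : R) : `|v| ^+ 2 = v ^+ 2 by rewrite real_normK ?num_real.
split.
  have := @convex_tangent _ z (derive1 h z - m * z) y cvx (is_deriveB _ _).
  by move=> /=; rewrite !sq; apply.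
have := @convex_tangent _ z (- (derive1 h z - l * z)) y ccv (is_deriveN _).
move=> /=; rewrite !sq => /(_ (is_deriveB _ _)); lra.
Qed.

Definition excess m F z := F z - m / 2 * z ^+ 2.
Definition slope m G z := G z - m * z.
Definition coslope l G z := l * z - G z.

(** Compare the lower bound at [z] with the upper bound at [y] in the point
[y + c (slope z - slope y)] and choose the best [c], namely [1 / (l - m)].  If
[l = m] every [c] is allowed and this forces the slopes to agree. *)
Lemma cocoercive m l F G : tangent_bounds m l F G -> m <= l ->
  forall y z, (slope m G z - slope m G y) ^+ 2 / 2 <=
    (l - m) * (excess m F y - excess m F z - slope m G z * (y - z)).
Proof.
move=> tb ml y z.
set E := excess m F y - excess m F z - slope m G z * (y - z).
set D := slope m G z - slope m G y.
have key c : (c - (l - m) / 2 * c ^+ 2) * D ^+ 2 <= E.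
  have [+ _] := tb (y + c * D) z; have [_ +] := tb (y + c * D) y.
  by rewrite /E /D /excess /slope; move: (F (_ + _)) => Fv h1 h2; lra.
move: ml; rewrite le_eqVlt => /orP[/eqP ml|ml]; last first.
  have k0 : l - m != 0 by rewrite subr_eq0 gt_eqF.
  have := key (l - m)^-1.
  rewrite (_ : _ - _ = (l - m)^-1 / 2); last by field.
  by rewrite -mulrA ler_pdivrMl ?subr_gt0// [2^-1 * _]mulrC.
have [->|D0] := eqVneq D 0; first by rewrite ml subrr mul0r expr0n mul0r.
(* with [l = m] and [D != 0] this [c] would give [E + 1 <= E] *)
have := key ((E + 1) / D ^+ 2).
by rewrite ml subrr mul0r mul0r subr0 divfK ?expf_neq0//; lra.
Qed.

(** The potential that certifies the Zames-Falb multipliers for the gradient of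
[F], shifted into the sector [0, l - m].  It is normalized to vanish at 0 when
[G 0 = 0]. *)
Definition storage m l F G z :=
  (l - m) * (excess m F z - excess m F 0) - slope m G z ^+ 2 / 2.

(** Cocoercivity rewritten: [coslope z - coslope y] is
[(l - m) (z - y) - (slope z - slope y)]. *)
Lemma storage_supply m l F G : tangent_bounds m l F G -> m <= l ->
  forall y z, storage m l F G z - storage m l F G y <=
    slope m G z * (coslope l G z - coslope l G y).
Proof.
move=> tb ml y z; have := cocoercive tb ml y z.
rewrite /storage (_ : coslope l G z - _ = (l - m) * (z - y)
  - (slope m G z - slope m G y)); last by rewrite /coslope /slope; ring.
by set a := slope _ _ z; set b := slope _ _ y; nra.
Qed.

Lemma storage0 m l F G : G 0 = 0 -> storage m l F G 0 = 0.
Proof. by rewrite /storage /slope => ->; ring. Qed.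

Lemma storage_ge0 m l F G z : tangent_bounds m l F G -> m <= l -> G 0 = 0 ->
  0 <= storage m l F G z.
Proof.
move=> tb ml G0; have := storage_supply tb ml z 0.
by rewrite (storage0 m l F G0) /slope G0 mulr0 subrr mul0r sub0r oppr_le0.
Qed.

Lemma storage_le_supply m l F G z :
  tangent_bounds m l F G -> m <= l -> G 0 = 0 ->
  storage m l F G z <= slope m G z * coslope l G z.
Proof.
move=> tb ml G0; have := storage_supply tb ml 0 z.
by rewrite (storage0 m l F G0) /coslope G0 mulr0 !subr0.
Qed.

(** Adding cocoercivity for [(y, z)] and for [(z, y)] makes [slope] Lipschitz.
Continuity of the gradients is what makes the iterates measurable. *)
Lemma tangent_bounds_continuous m l F G :
  tangent_bounds m l F G -> m <= l -> continuous G.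
Proof.
move=> tb ml.
have lip y z : `|slope m G z - slope m G y| <= (l - m) * `|z - y|.
  have := cocoercive tb ml y z; have := cocoercive tb ml z y.
  set a := slope _ _ z; set b := slope _ _ y => h1 h2.
  have h : (a - b) ^+ 2 <= (l - m) * (a - b) * (z - y) by nra.
  have [->|ab] := eqVneq (a - b) 0.
    by rewrite normr0 mulr_ge0 ?subr_ge0.
  have ab0 : 0 < `|a - b| by rewrite normr_gt0.
  rewrite -(ler_pM2l ab0) -expr2 real_normK ?num_real// (le_trans h)//.
  rewrite mulrCA -normrM [X in X <= _](_ : _ = (l - m) * ((a - b) * (z - y))).
    by rewrite ler_wpM2l ?subr_ge0// ler_norm.
  by ring.
have -> : G = slope m G \+ (fun z => m * z).
  by apply/funext => z; rewrite /slope/= subrK.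
move=> z; apply: cvgD; last exact: mulrl_continuous.
apply/cvgrPdist_le => e e0.
have [k0|k0] := eqVneq (l - m) 0.
  by near=> y; rewrite (le_trans (lip _ _))// k0 mul0r ltW.
have k1 : 0 < l - m by rewrite lt_neqAle eq_sym k0 subr_ge0.
have ke : 0 < (l - m)^-1 * e by rewrite mulr_gt0 ?invr_gt0.
near=> y; rewrite (le_trans (lip _ _))// -ler_pdivlMl//; near: y.
Unshelve. all: by end_near. Qed.

Definition mean N (a : 'I_N -> R) := N%:R^-1 * \sum_i a i.

Lemma mean_affine N (F G : 'I_N -> R) a b c : (0 < N)%N ->
  mean (fun i => a * F i + b * G i + c) = a * mean F + b * mean G + c.
Proof.
move=> N0; have N1 : N%:R != 0 :> R by rewrite pnatr_eq0 -lt0n.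
rewrite /mean !big_split/= -!mulr_sumr sumr_const card_ord !mulrDr.
by rewrite -[c *+ _]mulr_natl mulKf// ![N%:R^-1 * (_ * _)]mulrCA.
Qed.

Lemma ler_mean N (a b : 'I_N -> R) : (forall i, a i <= b i) -> mean a <= mean b.
Proof.
by move=> ab; rewrite /mean ler_wpM2l ?invr_ge0 ?ler0n// ler_sum.
Qed.

Lemma mean_tangent_bounds m l N (F G : 'I_N -> R -> R) : (0 < N)%N ->
  (forall i, tangent_bounds m l (F i) (G i)) ->
  tangent_bounds m l (fun z => mean (F^~ z)) (fun z => mean (G^~ z)).
Proof.
move=> N0 tb y z.
have aff c v : mean (F^~ v) - c = mean (fun i => 1 * F i v + 0 * G i v - c).
  by rewrite mean_affine// mul1r mul0r addr0.
have aff2 c d e v : mean (F^~ v) - c + (mean (G^~ v) - d) * e =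
    mean (fun i => 1 * F i v + e * G i v + (- c - d * e)).
  by rewrite mean_affine//; ring.
rewrite !aff2 !aff; split; apply: ler_mean => i.
  by have [] := tb i y z; lra.
by have [] := tb i y z; lra.
Qed.

(** [(g - m z) (l z - g)] is concave in [g] with second-order part [- g^2], so its
value at the mean of the [G i z] exceeds the mean of its values by exactly the
variance.  Those values are nonnegative because each [G i] vanishes at 0. *)
Lemma variance_le_supply m l N (F G : 'I_N -> R -> R) z : (0 < N)%N ->
  (forall i, tangent_bounds m l (F i) (G i)) -> m <= l ->
  (forall i, G i 0 = 0) ->
  mean (fun i => (G i z - mean (G^~ z)) ^+ 2) <=
    slope m (fun v => mean (G^~ v)) z * coslope l (fun v => mean (G^~ v)) z.
Proof.
move=> N0 tb ml G0; rewrite /slope /coslope; set g := mean (G^~ z).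
rewrite -subr_ge0.
have -> : (g - m * z) * (l * z - g) - mean (fun i => (G i z - g) ^+ 2) =
    mean (fun i => slope m (G i) z * coslope l (G i) z).
  transitivity (mean (fun i => (-1) * (G i z - g) ^+ 2
      + ((m + l) * z - 2 * g) * G i z + (g ^+ 2 - m * l * z ^+ 2))).
    by rewrite mean_affine// -/g; ring.
  by congr (_ * _); apply: eq_bigr => i _; rewrite /slope /coslope; ring.
rewrite /mean mulr_ge0 ?invr_ge0//; apply: sumr_ge0 => i _.
exact: le_trans (storage_ge0 z (tb i) ml (G0 i))
  (storage_le_supply z (tb i) ml (G0 i)).
Qed.

End function_class.

(** * Quadratic forms and the smallest eigenvalue *)

Section quadratic_forms.
Context {R : realType}.

Definition bform k (M : 'M[R]_k) (u v : 'cV[R]_k) : R := (u^T *m M *m v) 0 0.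

Definition sqnorm k (v : 'cV[R]_k) : R := \sum_i v i 0 ^+ 2.

Lemma bformE k (M : 'M[R]_k) u v :
  bform M u v = \sum_i \sum_j u i 0 * M i j * v j 0.
Proof.
rewrite /bform mxE exchange_big/=; apply: eq_bigr => j _.
rewrite mxE mulr_suml; apply: eq_bigr => i _.
by rewrite !mxE.
Qed.

Lemma bform1 k (v : 'cV[R]_k) : bform 1%:M v v = sqnorm v.
Proof.
by rewrite /bform mulmx1 mxE; apply: eq_bigr => i _; rewrite mxE expr2.
Qed.

Lemma bformDl k (M : 'M[R]_k) u1 u2 v :
  bform M (u1 + u2) v = bform M u1 v + bform M u2 v.
Proof. by rewrite /bform linearD/= !mulmxDl mxE. Qed.

Lemma bformDr k (M : 'M[R]_k) u v1 v2 :
  bform M u (v1 + v2) = bform M u v1 + bform M u v2.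
Proof. by rewrite /bform mulmxDr mxE. Qed.

Lemma bformZl k (M : 'M[R]_k) a u v : bform M (a *: u) v = a * bform M u v.
Proof. by rewrite /bform linearZ/= -!scalemxAl mxE. Qed.

Lemma bformZr k (M : 'M[R]_k) a u v : bform M u (a *: v) = a * bform M u v.
Proof. by rewrite /bform -scalemxAr mxE. Qed.

Lemma bform_sym k (M : 'M[R]_k) u v : M^T = M -> bform M u v = bform M v u.
Proof.
move=> sM; rewrite /bform; transitivity ((u^T *m M *m v)^T 0 0).
  by rewrite [RHS]mxE.
by rewrite !trmx_mul trmxK sM mulmxA.
Qed.

Lemma bform_shift k (M : 'M[R]_k) a v :
  bform (M - a%:M) v v = bform M v v - a * sqnorm v.
Proof.
rewrite -bform1 /bform mulmxBr mulmxBl mxE [in X in _ + X]mxE.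
by rewrite mul_mx_scalar mulmx1 -scalemxAl [in X in _ - X]mxE.
Qed.

Lemma sqnorm_ge0 k (v : 'cV[R]_k) : 0 <= sqnorm v.
Proof. by apply: sumr_ge0 => i _; rewrite sqr_ge0. Qed.

Lemma sqnorm_eq0 k (v : 'cV[R]_k) : (sqnorm v == 0) = (v == 0).
Proof.
apply/eqP/eqP => [v0|->]; last first.
  by rewrite /sqnorm big1// => i _; rewrite mxE expr0n.
apply/matrixP => i j; rewrite ord1 mxE; apply/eqP; rewrite -sqrf_eq0.
by apply/eqP; apply: (psumr_eq0P _ v0) => // l _; rewrite sqr_ge0.
Qed.

Lemma sqnorm0 k : sqnorm (0 : 'cV[R]_k) = 0.
Proof. by apply/eqP; rewrite sqnorm_eq0. Qed.

Lemma discriminant_le (a b c : R) : 0 <= a ->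
  (forall t, 0 <= a * t ^+ 2 + 2 * b * t + c) -> b ^+ 2 <= a * c.
Proof.
rewrite le_eqVlt => /orP[/eqP <-|a0] H.
  have [->|b0] := eqVneq b 0; first by rewrite mul0r expr0n.
  have := H (- (c + 1) / (2 * b)).
  by rewrite mul0r add0r mulrCA divff ?mulf_neq0// ?pnatr_eq0//; lra.
have := H (- b / a); rewrite -(pmulr_rge0 _ a0) -[b ^+ 2 <= _]subr_ge0.
by congr (_ <= _); field; rewrite gt_eqF.
Qed.

Lemma bform_Cauchy k (M : 'M[R]_k) u v : M^T = M ->
  (forall w, 0 <= bform M w w) ->
  bform M u v ^+ 2 <= bform M u u * bform M v v.
Proof.
move=> sM psd; apply: discriminant_le => // t.
have := psd (t *: u + v).
rewrite !(bformDl, bformDr, bformZl, bformZr) (bform_sym v u sM).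
by congr (_ <= _); ring.
Qed.

Lemma bform_bounded k (M : 'M[R]_k) :
  exists2 K, 0 < K & forall v, bform M v v <= K * sqnorm v.
Proof.
exists (1 + \sum_i \sum_j `|M i j|) => [|v].
  by rewrite ltr_wpDr// sumr_ge0// => i _; rewrite sumr_ge0.
rewrite mulrDl mul1r ler_wpDl ?sqnorm_ge0// bformE mulr_suml ler_sum// => i _.
rewrite mulr_suml ler_sum// => j _.
have le1 l : v l 0 ^+ 2 <= sqnorm v.
  by rewrite /sqnorm (bigD1 l)//= lerDl sumr_ge0// => ? _; rewrite sqr_ge0.
rewrite (le_trans (ler_norm _))// mulrAC normrM mulrC ler_wpM2l//.
have := le1 i; have := le1 j; have := ler_norm (v i 0 * v j 0).
rewrite ler_norml; move: (v i 0) (v j 0) (sqnorm v) => a b c ? ? ?.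
by apply/andP; split; nra.
Qed.

(** By Cauchy-Schwarz for the form [M], applied to [v] and [M^-1 v],
[|v|^4 <= (v^T M v) (v^T M^-1 v)], and the last factor is at most [K |v|^2]. *)
Lemma psd_unit_coercive k (M : 'M[R]_k) : M^T = M ->
  (forall w, 0 <= bform M w w) -> M \in unitmx ->
  exists2 c, 0 < c & forall v, c * sqnorm v <= bform M v v.
Proof.
move=> sM psd uM; have [K K0 HK] := bform_bounded (invmx M).
exists K^-1; first by rewrite invr_gt0.
move=> v; rewrite ler_pdivrMl//.
have [->|v0] := eqVneq v 0.
  by rewrite sqnorm0 mulr_ge0 ?psd ?ltW.
have sv0 : 0 < sqnorm v by rewrite lt_neqAle eq_sym sqnorm_eq0 v0 sqnorm_ge0.
have := bform_Cauchy v (invmx M *m v) sM psd.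
rewrite {1}/bform -mulmxA (mulmxA M) mulmxV// mul1mx.
rewrite -[v^T]mulmx1 -/(bform _ _ _) bform1.
have -> : bform M (invmx M *m v) (invmx M *m v) = bform (invmx M) v v.
  rewrite /bform trmx_mul trmx_inv sM -!mulmxA.
  by rewrite (mulmxA M) mulmxV// mul1mx.
move=> h; have := le_trans h (ler_wpM2l (psd v) (HK v)).
by rewrite expr2 mulrA ler_pM2r// mulrC.
Qed.

Lemma posdef_bform_ge0 k (M : 'M[R]_k) v : posdef M -> 0 <= bform M v v.
Proof.
move=> [_ pM]; have [->|/pM/ltW//] := eqVneq v 0.
by rewrite /bform mulmx0 mxE.
Qed.

Lemma posdef_eigenvalue_gt0 k (M : 'M[R]_k) a :
  posdef M -> eigenvalue M a -> 0 < a.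
Proof.
move=> [sM pM] /eigenvalueP [v vM v0].
have /pM : v^T != 0 by rewrite -(inj_eq trmx_inj) trmxK trmx0.
rewrite trmxK vM -scalemxAl mxE -[v]trmxK trmxK.
rewrite (_ : (v *m v^T) 0 0 = sqnorm v^T); last first.
  by rewrite -bform1 /bform trmxK mulmx1.
by rewrite pmulr_lgt0// lt_neqAle sqnorm_ge0 andbT eq_sym
  sqnorm_eq0 -(inj_eq trmx_inj) trmxK trmx0.
Qed.

Lemma lambda_min_ge0 k (M : 'M[R]_k) : posdef M -> 0 <= lambda_min M.
Proof.
move=> pM; rewrite /lambda_min.
have [->|/set0P ne] := eqVneq [set a | eigenvalue M a] set0.
  by rewrite inf0.
by apply: lb_le_inf => // a /(posdef_eigenvalue_gt0 pM)/ltW.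
Qed.

(** Let [mu] be the infimum of the Rayleigh quotient.  [M - mu] is positive
semidefinite; if it were invertible it would be coercive and [mu] could be
increased.  So [mu] is an eigenvalue, and [lambda_min M <= mu]. *)
Lemma lambda_min_le_bform k (M : 'M[R]_k) v : posdef M ->
  lambda_min M * sqnorm v <= bform M v v.
Proof.
move=> pM; have [sM _] := pM.
have [->|v0] := eqVneq v 0.
  by rewrite sqnorm0 mulr0 posdef_bform_ge0.
have sv (w : 'cV[R]_k) : w != 0 -> 0 < sqnorm w.
  by move=> w0; rewrite lt_neqAle eq_sym sqnorm_eq0 w0 sqnorm_ge0.
pose Q := [set bform M w w / sqnorm w | w in [set w | w != 0]].
pose mu := inf Q.
have Qlb : lbound Q 0.
  by move=> _ [w /= w0 <-]; rewrite divr_ge0 ?sqnorm_ge0 ?posdef_bform_ge0.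
have Qn0 : Q !=set0 by exists (bform M v v / sqnorm v), v.
have muP w : mu * sqnorm w <= bform M w w.
  have [->|w0] := eqVneq w 0.
    by rewrite sqnorm0 mulr0 posdef_bform_ge0.
  by rewrite -ler_pdivlMr ?sv//; apply: ge_inf; [exists 0|exists w].
have psd w : 0 <= bform (M - mu%:M) w w by rewrite bform_shift subr_ge0.
have sMmu : (M - mu%:M)^T = M - mu%:M by rewrite linearB/= sM tr_scalar_mx.
have mu_eig : eigenvalue M mu.
  rewrite /eigenvalue /eigenspace kermx_eq0 row_free_unit; apply/negP => uM.
  have [c c0 Hc] := psd_unit_coercive sMmu psd uM.
  suff : mu + c <= mu by rewrite gerDl leNgt c0.
  apply: lb_le_inf => //.
  move=> _ [w /= w0 <-]; rewrite ler_pdivlMr ?sv//.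
  by have := Hc w; rewrite bform_shift; lra.
apply: le_trans (muP v); rewrite ler_wpM2r ?sqnorm_ge0//.
by apply: ge_inf => //; exists 0 => a /(posdef_eigenvalue_gt0 pM)/ltW.
Qed.

Lemma sqr_mulmx_le k (C : 'rV[R]_k) (v : 'cV[R]_k) :
  (C *m v) 0 0 ^+ 2 <= enorm C^T ^+ 2 * sqnorm v.
Proof.
have psd1 (w : 'cV[R]_k) : 0 <= bform 1%:M w w by rewrite bform1 sqnorm_ge0.
have := bform_Cauchy C^T v (trmx1 _ _) psd1.
rewrite !bform1 /bform trmxK mulmx1 /enorm sqr_sqrtr//.
exact: sqnorm_ge0.
Qed.

End quadratic_forms.

(** * The supermartingale along batch histories *)

Section histories.
Context {R : realType} {T : eqType} {n s : nat}.
Context (m l rho nu btil : R) (A : 'M[R]_n) (B : 'cV[R]_n) (C : 'rV[R]_n).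
Context (P : 'M[R]_(n + s)) (lam : 'I_s.+1 -> R).
Context (F g : R -> R) (G : T -> R -> R) (K : seq T) (p : nat -> T -> R).
Context (x0 : 'cV[R]_n).

(** A history lists the batches drawn so far, the latest first, so that
[size h] is the current time and [drop j h] is the history [j] steps ago. *)
Fixpoint state (h : seq T) : 'cV[R]_n :=
  if h is J :: h' then
    A *m state h' + B *m (G J ((C *m state h') 0 0))%:M
  else x0.

Definition query h := (C *m state h) 0 0.

(** Signals vanish before time 0. *)
Definition past (q : seq T -> R) j h :=
  if (j <= size h)%N then q (drop j h) else 0.

Definition scaled_coslope h := rho ^- size h * coslope l g (query h).
Definition scaled_slope h := rho ^- size h * slope m g (query h).
Definition scaled_supply h :=
  rho ^- (2 * size h) * (slope m g (query h) * coslope l g (query h)).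
Definition scaled_storage h := rho ^- (2 * size h) * storage m l F g (query h).

Definition filter_state h : 'cV[R]_s := \col_i past scaled_coslope (s - i) h.

Definition joint_state h : 'cV[R]_(n + s) :=
  col_mx (rho ^- size h *: state h) (filter_state h).

Definition lyapunov h := bform P (joint_state h) (joint_state h).

(** The storage still to be released by the delayed terms: the term with delay
[j] keeps the storages of the [j] most recent query points.  The inner sum is
empty for [j = 0], so only the nonpositive coefficients contribute. *)
Definition stored h := 2 * \sum_(j < s.+1) (- lam j * rho ^- j) *
  \sum_(k < j) past scaled_storage k.+1 h.

Lemma past_cons q j J h : past q j.+1 (J :: h) = past q j h.
Proof. by []. Qed.

Lemma past0 q h : past q 0 h = q h.
Proof. by rewrite /past drop0. Qed.

Section step.
Context (rho0 : 0 < rho).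

(** The first block is the algorithm after writing its input as
[m z + slope + error]; the second one shifts the register and feeds it with
[(l - m) z - slope], which is [coslope]. *)
Lemma joint_state_cons J h :
  joint_state (J :: h) = calA s m l rho A B C *m joint_state h
    + scaled_slope h *: calB1 s rho B
    + (rho ^- size h * (G J (query h) - g (query h))) *: calB2 s rho B.
Proof.
rewrite /joint_state /calA /calB1 /calB2 mul_block_col !scale_col_mx !add_col_mx.
congr col_mx.
- have Cx : C *m state h = (query h)%:M by rewrite [LHS]mx11_scalar.
  have rk : rho ^- (size h).+1 = rho^-1 * rho ^- size h.
    by rewrite exprS invfM.
  have -> : rho^-1 *: (A + m *: (B *m C)) *m (rho ^- size h *: state h) =
      rho ^- (size h).+1 *: (A *m state h)
      + (rho ^- (size h).+1 * (m * query h)) *: B.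
    rewrite -scalemxAl -scalemxAr mulmxDl -scalemxAl -mulmxA Cx mul_mx_scalar.
    by rewrite rk !scalerDr !scalerA !mulrA.
  rewrite mul0mx addr0 /= -/(query h) mul_mx_scalar scalerDr !scalerA -!addrA.
  congr (_ + _); rewrite -!scalerDl; congr (_ *: _).
  by rewrite /scaled_slope /slope rk [in RHS]/GRing.scale/=; ring.
- rewrite scaler0 addr0 scalerN; apply/matrixP => i j; rewrite ord1 {j}.
  have -> : ((l - m) *: (B_psi R s *m C) *m (rho ^- size h *: state h)) =
      ((l - m) * (rho ^- size h * query h)) *: B_psi R s.
    have Cx : C *m state h = (query h)%:M by rewrite [LHS]mx11_scalar.
    by rewrite -scalemxAl -scalemxAr -mulmxA Cx mul_mx_scalar !scalerA mulrA.
  have Axi : (A_psi R s *m filter_state h) i 0 =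
      if i.+1 == s then 0 else past scaled_coslope (s - i.+1) h.
    rewrite mxE; case: eqP => [iS|/eqP iS].
      rewrite big1// => j _; rewrite !mxE iS ltn_eqF ?mul0r//.
    have iS' : (i.+1 < s)%N by rewrite ltn_neqAle iS ltn_ord.
    rewrite (bigD1 (Ordinal iS'))//= big1 => [|j jS]; rewrite !mxE/=.
      by rewrite eqxx mul1r addr0.
    rewrite (_ : (j == i.+1 :> nat) = false) ?mul0r//.
    by apply/negbTE; apply: contra jS => /eqP ji; apply/eqP/val_inj.
  rewrite [RHS]mxE [X in _ = X + _]mxE {}Axi !mxE.
  have -> : (s - i = (s - i.+1).+1)%N by rewrite -subSn.
  rewrite past_cons; case: eqP => [->|_]; last first.
    by rewrite !mulr0n; ring.
  rewrite subnn past0 /scaled_coslope /scaled_slope /coslope /slope.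
  by rewrite /=; ring.
Qed.

(** [C_psi] lists the coefficients from [lam s] down to [lam 1] while the register
lists past values from the oldest to the latest, hence the reversal. *)
Lemma joint_output h : (calC lam m l C *m joint_state h
    + scaled_slope h *: calD1 lam) 0 0 =
  \sum_(j < s.+1) lam j * past scaled_coslope j h.
Proof.
rewrite big_ord_recl past0 mxE /calC /joint_state mul_row_col [X in X + _]mxE.
rewrite addrAC; congr (_ + _).
  rewrite /calD1 /D_psi -scalemxAl -scalemxAr -mulmxA.
  have -> : C *m state h = (query h)%:M by rewrite [LHS]mx11_scalar.
  rewrite -scalar_mxM !mxE/= !mulr1n.
  by rewrite /scaled_coslope /scaled_slope /coslope /slope; ring.
rewrite mxE (reindex_inj rev_ord_inj)/=; apply: eq_bigr => i _.
rewrite !mxE; congr (lam _ * past _ _ _).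
  by apply/val_inj; rewrite /= subSS subKn.
by rewrite subKn.
Qed.

(** The quadratic form of [lmi_mx] at the vector [(y, u)]. *)
Lemma lmi_dissipation y (u : R) a : negdef (lmi_mx lam m l rho A B C P) ->
  a = calA s m l rho A B C *m y + u *: calB1 s rho B ->
  bform P a a + 2 * (u * (calC lam m l C *m y + u *: calD1 lam) 0 0)
    <= bform P y y.
Proof.
move=> neg aE; rewrite -subr_le0.
set v := col_mx y (u%:M : 'M[R]_1).
have congrE k (M : 'M[R]_k) (H : 'M[R]_(k, n + s + 1)) :
    bform (H^T *m M *m H) v v = bform M (H *m v) (H *m v).
  by rewrite /bform trmx_mul !mulmxA.
have := posdef_bform_ge0 v neg.
rewrite {1}/bform mulmxN mulNmx mxE oppr_ge0 -/(bform _ _ _) /lmi_mx.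
have bformDm (M1 M2 : 'M[R]_(n + s + 1)) :
    bform (M1 + M2) v v = bform M1 v v + bform M2 v v.
  by rewrite /bform mulmxDr mulmxDl mxE.
rewrite bformDm !congrE /v !mul_block_col mul1mx mul0mx addr0 mul_mx_scalar -aE.
rewrite mul0mx mul1mx add0r mul_mx_scalar.
set o := _ + u *: calD1 lam.
rewrite /bform !tr_col_mx !mul_row_block !mulmx0 !mulmx1 addr0 !add0r.
rewrite !mul_row_col.
rewrite mulmxN mulNmx tr_scalar_mx mul_scalar_mx mul_mx_scalar !mxE.
by rewrite -/o addrAC; lra.
Qed.

Lemma bformD_sym k (M : 'M[R]_k) a c e : M^T = M ->
  bform M (a + e *: c) (a + e *: c) =
  bform M a a + 2 * bform M a c * e + bform M c c * e ^+ 2.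
Proof.
move=> sM; rewrite !(bformDl, bformDr, bformZl, bformZr) (bform_sym c a sM).
by ring.
Qed.

Section storage_function.
Context (tb : tangent_bounds m l F g) (ml : m <= l) (g0 : g 0 = 0).
Context (rho1 : rho <= 1).
Context (lam_le0 : forall j : 'I_s.+1, (0 < j)%N -> lam j <= 0).

Lemma stored_nil : stored [::] = 0.
Proof.
by rewrite /stored big1 ?mulr0// => j _; rewrite big1 ?mulr0.
Qed.

Lemma past_storage_ge0 j h : 0 <= past scaled_storage j h.
Proof.
rewrite /past; case: ifP => // _.
by rewrite mulr_ge0 ?storage_ge0// invr_ge0 exprn_ge0// ltW.
Qed.

Lemma stored_ge0 h : 0 <= stored h.
Proof.
rewrite mulr_ge0// sumr_ge0// => j _; have [j0|j0] := posnP j.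
  by rewrite big1 ?mulr0// => -[k]; rewrite j0.
rewrite mulr_ge0 ?sumr_ge0// => [|k _]; last exact: past_storage_ge0.
by rewrite mulr_ge0 ?oppr_ge0 ?lam_le0// invr_ge0 exprn_ge0// ltW.
Qed.

(** With [r = rho^(2 j)] in [0, 1], split [u q - r u q'] into
[(1 - r) u q + r u (q - q')]: the first part is at least [(1 - r) H] and the
second at least [r (H - H')].  This is where [rho <= 1] is used.  Before time
[j] there is no delayed value and [u q >= H] suffices. *)
Lemma discounted_supply j h :
  past scaled_storage 0 h - past scaled_storage j h <=
  scaled_supply h - rho ^+ j * (scaled_slope h * past scaled_coslope j h).
Proof.
rewrite past0.
have r0 k : 0 < rho ^- k by rewrite invr_gt0 exprn_gt0.
rewrite /past; case: ifP => jh; last first.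
  rewrite !mulr0 !subr0 /scaled_storage /scaled_supply ler_pM2l//.
  exact: storage_le_supply.
rewrite /scaled_storage /scaled_supply /scaled_slope /scaled_coslope size_drop.
set z := query h; set y := query (drop j h); set t := size h.
have e k : rho ^+ (2 * k) = rho ^+ k ^+ 2 by rewrite mulnC exprM.
have nz k : rho ^+ k != 0 by rewrite expf_neq0// gt_eqF.
have [c tE] : exists c, t = (c + j)%N by exists (t - j)%N; rewrite subnK.
have e1 : rho ^- (2 * (t - j)) = rho ^- (2 * t) * rho ^+ (2 * j).
  by rewrite tE addnK !e !exprD; field; rewrite !nz.
have e2 : rho ^+ j * (rho ^- t * rho ^- (t - j)) =
    rho ^- (2 * t) * rho ^+ (2 * j).
  by rewrite tE addnK !e !exprD; field; rewrite !nz.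
rewrite e1.
have -> : rho ^+ j * (rho ^- t * slope m g z *
      (rho ^- (t - j) * coslope l g y)) =
    rho ^- (2 * t) * rho ^+ (2 * j) * (slope m g z * coslope l g y).
  by rewrite -e2; ring.
rewrite -!mulrA -!mulrBr ler_pM2l//.
have q0 : 0 <= rho ^+ (2 * j) by rewrite exprn_ge0// ltW.
have q1 : rho ^+ (2 * j) <= 1 by rewrite exprn_ile1// ltW.
have := storage_le_supply z tb ml g0.
have := storage_supply tb ml y z.
move: (rho ^+ (2 * j)) q0 q1 => r; nra.
Qed.

(** Write the delayed term [lam j u q_{t-j}] as [lam j rho^-j] times [u q_t] plus
[- lam j rho^-j] times the difference bounded in [discounted_supply]; the first
parts add up to [nu u q], the second ones telescope into [stored].  The new batch
[J] does not affect [stored (J :: h)], which looks at past query points only. *)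
Lemma supply_ge h J : nu = \sum_(j < s.+1) rho ^- j * lam j ->
  nu * scaled_supply h + (stored (J :: h) - stored h) / 2 <=
  scaled_slope h * \sum_(j < s.+1) lam j * past scaled_coslope j h.
Proof.
move=> nuE.
have -> : (stored (J :: h) - stored h) / 2 =
    \sum_(j < s.+1) (- lam j * rho ^- j) *
      (past scaled_storage 0 h - past scaled_storage j h).
  rewrite /stored -mulrBr mulrAC divff ?mul1r ?pnatr_eq0// -sumrB.
  apply: eq_bigr => j _; rewrite -mulrBr -sumrB; congr (_ * _).
  rewrite (eq_bigr (fun k : 'I_j =>
      - (past scaled_storage k.+1 h - past scaled_storage k h))) => [|k _].
    rewrite sumrN -(big_mkord xpredT (fun k =>
      past scaled_storage k.+1 h - past scaled_storage k h)).
    by rewrite telescope_sumr// opprB.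
  by rewrite past_cons opprB.
rewrite nuE mulr_suml mulr_sumr -big_split/= ler_sum// => j _.
have [j0|j0] := posnP j.
  by rewrite j0 subrr mulr0 addr0 past0 /scaled_supply /scaled_slope
   /scaled_coslope expr0 invr1 mul1r mulnC exprM expr2 invfM; lra.
have L0 : 0 <= - lam j * rho ^- j.
  by rewrite mulr_ge0 ?oppr_ge0 ?lam_le0// invr_ge0 exprn_ge0// ltW.
have := ler_wpM2l L0 (discounted_supply j h).
rewrite -!lerBrDl => /le_trans; apply.
rewrite le_eqVlt; apply/orP; left; apply/eqP; field.
by rewrite expf_neq0// gt_eqF.
Qed.

(** All that is used about the sampling of one batch: the mini-batch gradient is
unbiased, and the supply pays for [btil] times its variance. *)
Definition unbiased_law (q : T -> R) :=
  [/\ forall J, 0 <= q J, \sum_(J <- K) q J = 1,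
      forall z, \sum_(J <- K) q J * G J z = g z &
      forall z, btil * \sum_(J <- K) q J * (G J z - g z) ^+ 2 <=
                slope m g z * coslope l g z].

Context (Ppos : posdef P) (lmi : negdef (lmi_mx lam m l rho A B C P)).
Context (nuE : nu = \sum_(j < s.+1) rho ^- j * lam j) (nu0 : 0 <= nu).
Context (noise : bform P (calB2 s rho B) (calB2 s rho B) <= 2 * btil * nu).

(** Expand [lyapunov (J :: h)] around the noiseless successor: the linear term in
the error averages to 0, and [noise] with the variance bound makes the quadratic
term at most [2 nu] times the supply, which [supply_ge] provides. *)
Lemma supermartingale_step q h : unbiased_law q ->
  \sum_(J <- K) q J * (lyapunov (J :: h) + stored (J :: h)) <=
    lyapunov h + stored h.
Proof.
move=> [q0 q1 qmean qvar]; have [sP _] := Ppos.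
pose a := calA s m l rho A B C *m joint_state h
  + scaled_slope h *: calB1 s rho B.
pose c := calB2 s rho B.
pose r := rho ^- size h.
pose e J := r * (G J (query h) - g (query h)).
have r2 : r ^+ 2 = rho ^- (2 * size h) by rewrite /r exprVn mulnC exprM.
have mean_e : \sum_(J <- K) q J * e J = 0.
  under eq_bigr do rewrite /e mulrCA mulrBr.
  by rewrite -mulr_sumr sumrB qmean -mulr_suml q1 mul1r subrr mulr0.
have var_e : bform P c c * \sum_(J <- K) q J * e J ^+ 2 <=
    2 * nu * scaled_supply h.
  under eq_bigr do rewrite /e exprMn mulrCA.
  rewrite -mulr_sumr r2 /scaled_supply mulrCA [leRHS]mulrCA.
  rewrite ler_pM2l ?invr_gt0 ?exprn_gt0//.
  set V := \sum_(_ <- _) _.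
  have V0 : 0 <= V by rewrite sumr_ge0// => J _; rewrite mulr_ge0// sqr_ge0.
  apply: (le_trans (ler_wpM2r V0 noise)).
  have /(ler_wpM2l nu0) := qvar (query h); rewrite -/V => qv.
  rewrite (_ : _ * V = 2 * (nu * (btil * V))); last by ring.
  by rewrite -[leRHS]mulrA ler_pM2l.
have step J : lyapunov (J :: h) =
    bform P a a + 2 * bform P a c * e J + bform P c c * e J ^+ 2.
  by rewrite /lyapunov joint_state_cons -/a bformD_sym.
have sup J : bform P a a + 2 * nu * scaled_supply h + stored (J :: h) <=
    lyapunov h + stored h.
  have := lmi_dissipation lmi (erefl a); rewrite joint_output.
  by have := supply_ge h J nuE; rewrite /lyapunov; lra.
have : \sum_(J <- K) q J * (lyapunov (J :: h) + stored (J :: h)) =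
  \sum_(J <- K) q J * (bform P a a + stored (J :: h)) +
  (2 * bform P a c * \sum_(J <- K) q J * e J
  + bform P c c * \sum_(J <- K) q J * e J ^+ 2).
  rewrite !mulr_sumr -!big_split/=; apply: eq_bigr => J _.
  by rewrite step; ring.
move=> ->; rewrite mean_e mulr0 add0r.
apply: (le_trans (lerD (lexx _) var_e)).
have avg X : X = \sum_(J <- K) q J * X by rewrite -mulr_suml q1 mul1r.
rewrite [X in _ + X <= _]avg [leRHS]avg -big_split/= ler_sum// => J _.
by rewrite -mulrDr ler_wpM2l//; have := sup J; lra.
Qed.

Context (law : forall t, unbiased_law (p t)).

Fixpoint histories t : seq (seq T) :=
  if t is t'.+1 then [seq J :: h | h <- histories t', J <- K] else [:: [::]].

(** The probability of a history under independent draws with laws [p t]. *)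
Fixpoint weight (h : seq T) : R :=
  if h is J :: h' then weight h' * p (size h') J else 1.

Lemma big_historiesS t (phi : seq T -> R) :
  \sum_(h <- histories t.+1) phi h =
  \sum_(h <- histories t) \sum_(J <- K) phi (J :: h).
Proof. exact: big_allpairs_dep. Qed.

Lemma weight_ge0 h : 0 <= weight h.
Proof.
by elim: h => //= J h IH; rewrite mulr_ge0//; have [] := law (size h).
Qed.

Lemma mean_lyapunov_le t :
  \sum_(h <- histories t) weight h * lyapunov h <= lyapunov [::].
Proof.
apply: (@le_trans _ _
    (\sum_(h <- histories t) weight h * (lyapunov h + stored h))).
  rewrite ler_sum// => h _.
  by rewrite ler_wpM2l ?weight_ge0// lerDl stored_ge0.
elim: t => [|t IH]; first by rewrite big_seq1 mul1r stored_nil addr0.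
rewrite (le_trans _ IH)// big_historiesS ler_sum// => h _ /=.
under eq_bigr do rewrite -mulrA.
rewrite -mulr_sumr ler_wpM2l ?weight_ge0//.
exact: supermartingale_step.
Qed.

Lemma size_histories t h : h \in histories t -> size h = t.
Proof.
elim: t h => [|t IH] h; first by rewrite inE => /eqP ->.
by move=> /allpairsP[[h' J] [/IH <- _ ->]].
Qed.

Lemma query_sqr_le h :
  lambda_min P * query h ^+ 2 <=
    enorm C^T ^+ 2 * rho ^+ (2 * size h) * lyapunov h.
Proof.
have lm0 := lambda_min_ge0 Ppos.
apply: (le_trans (ler_wpM2l lm0 (sqr_mulmx_le _ _))).
rewrite mulrCA -mulrA ler_wpM2l ?sqr_ge0//.
rewrite -ler_pdivrMl ?exprn_gt0//.
apply: le_trans (lambda_min_le_bform (joint_state h) Ppos).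
rewrite mulrCA ler_wpM2l//.
rewrite /sqnorm big_split_ord/= ler_wpDr ?sumr_ge0// => [i _|].
  exact: sqr_ge0.
rewrite mulr_sumr ler_sum// => i _.
by rewrite col_mxEu mxE exprMn exprVn mulnC exprM.
Qed.

Lemma mean_query_le t :
  lambda_min P * (\sum_(h <- histories t) weight h * query h ^+ 2) <=
  enorm C^T ^+ 2 * rho ^+ (2 * t) * bform P (col_mx x0 0) (col_mx x0 0).
Proof.
have -> : bform P (col_mx x0 0) (col_mx x0 0) = lyapunov [::].
  rewrite /lyapunov /joint_state /= expr0 invr1 scale1r.
  (* the register is empty at time 0 since [0 < s - i] *)
  congr (bform P (col_mx _ _) (col_mx _ _));
  by apply/matrixP => i j; rewrite !mxE /past/= leqn0 subn_eq0 leqNgt ltn_ord.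
have c0 : 0 <= enorm C^T ^+ 2 * rho ^+ (2 * t).
  by rewrite mulr_ge0 ?sqr_ge0// exprn_ge0// ltW.
apply: le_trans (ler_wpM2l c0 (mean_lyapunov_le t)).
rewrite !mulr_sumr !big_seq ler_sum// => h ht.
by rewrite mulrCA [leRHS]mulrCA ler_wpM2l ?weight_ge0// -(size_histories ht)
  query_sqr_le.
Qed.

End storage_function.
End step.
End histories.

(** * Mean and variance of a mini-batch *)

Section finite_laws.
Context d (Omega : measurableType d) (R : realType) (Pr : probability Omega R).

Definition pmass (S : Type) (X : Omega -> S) (x : S) : R :=
  fine (Pr (X @^-1` [set x])).

Lemma pmass_ge0 (S : Type) (X : Omega -> S) x : 0 <= pmass X x.
Proof. by rewrite fine_ge0. Qed.

Lemma pmassE (S : Type) (X : Omega -> S) x :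
  measurable (X @^-1` [set x]) -> Pr (X @^-1` [set x]) = (pmass X x)%:E.
Proof. by move=> mX; rewrite fineK// fin_num_measure. Qed.

Lemma measurable_preimage_seq (S : eqType) (X : Omega -> S) (s : seq S) :
  (forall x, measurable (X @^-1` [set x])) -> measurable (X @^-1` [set` s]).
Proof.
move=> mX; elim: s => [|x s IH].
  by rewrite (_ : X @^-1` _ = set0)//; apply/seteqP; split.
rewrite (_ : X @^-1` _ = X @^-1` [set x] `|` X @^-1` [set` s]).
  exact: measurableU.
apply/seteqP; split => w /=; rewrite inE; first by case/predU1P; [left|right].
by case=> [->|->]; rewrite ?eqxx ?orbT.
Qed.

Lemma measure_preimage_seq (S : eqType) (X : Omega -> S) (s : seq S) :
  (forall x, measurable (X @^-1` [set x])) -> uniq s ->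
  Pr (X @^-1` [set` s]) = (\sum_(x <- s) pmass X x)%:E.
Proof.
move=> mX; elim: s => [_|x s IH /= /andP[xs us]].
  by rewrite (_ : X @^-1` _ = set0) ?measure0 ?big_nil//; apply/seteqP; split.
rewrite (_ : X @^-1` _ = X @^-1` [set x] `|` X @^-1` [set` s]).
  have mXs := measurable_preimage_seq s mX.
  rewrite measureU//; first by rewrite big_cons EFinD -pmassE// -IH.
  by apply/seteqP; split => // w [/= ->]; rewrite (negPf xs).
apply/seteqP; split => w /=; rewrite inE; first by case/predU1P; [left|right].
by case=> [->|->]; rewrite ?eqxx ?orbT.
Qed.

Lemma sum_pmass (S : eqType) (X : Omega -> S) (s : seq S) :
  (forall x, measurable (X @^-1` [set x])) -> uniq s -> (forall w, X w \in s) ->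
  \sum_(x <- s) pmass X x = 1.
Proof.
move=> mX us Xs; apply: EFin_inj; rewrite -measure_preimage_seq//.
rewrite (_ : X @^-1` _ = setT) ?probability_setT//.
by apply/seteqP; split => // w _ /=; rewrite Xs.
Qed.

Lemma sigma_of_fiber (S : Type) (X : Omega -> S) x :
  sigma_of (discrete S) X (X @^-1` [set x]).
Proof. by exists [set x] => //; rewrite setTI. Qed.

Section transfer.
Context (T : finType) (S : eqType) (Y : Omega -> T) (e : T -> S).
Context (mY : forall t, measurable (Y @^-1` [set t])).

Lemma measurable_fiber_comp x : measurable ((e \o Y) @^-1` [set x]).
Proof.
rewrite (_ : _ @^-1` _ = Y @^-1` [set` [seq t <- enum T | e t == x]]).
  exact: measurable_preimage_seq.
apply/seteqP; split => w /=.
  by move=> <-; rewrite mem_filter eqxx mem_enum.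
by rewrite mem_filter mem_enum andbT => /eqP.
Qed.

Lemma pmass_comp x : pmass (e \o Y) x = \sum_(t | e t == x) pmass Y t.
Proof.
rewrite {1}/pmass.
rewrite (_ : _ @^-1` _ = Y @^-1` [set` [seq t <- enum T | e t == x]]).
  have u : uniq [seq t <- enum T | e t == x] by rewrite filter_uniq ?enum_uniq.
  by rewrite measure_preimage_seq//= big_filter big_enum_cond.
apply/seteqP; split => w /=.
  by move=> <-; rewrite mem_filter eqxx mem_enum.
by rewrite mem_filter mem_enum andbT => /eqP.
Qed.

(** Change of variables: the law of [e \o Y] on the left, that of [Y] on the
right. *)
Lemma sum_pmass_comp (K : seq S) (phi : S -> R) :
  uniq K -> (forall t, e t \in K) ->
  \sum_(x <- K) pmass (e \o Y) x * phi x = \sum_t pmass Y t * phi (e t).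
Proof.
move=> uK eK.
under eq_bigr do rewrite pmass_comp mulr_suml.
rewrite (exchange_big_dep xpredT)//=; apply: eq_bigr => t _.
have Kt : [seq x <- K | e t == x] = [:: e t].
  rewrite -(filter_pred1_uniq uK (eK t)).
  by apply: eq_filter => x; rewrite /= eq_sym.
by rewrite -big_filter Kt big_seq1.
Qed.

End transfer.

End finite_laws.

Lemma big_seq_mset (R : Type) (idx : R) (op : Monoid.com_law idx) (T : choiceType)
  (s : seq T) (F : T -> R) :
  \big[op/idx]_(i <- seq_mset s) F i = \big[op/idx]_(i <- s) F i.
Proof. exact/perm_big/perm_eq_seq_mset. Qed.

Section uniform_moments.
Context {R : realType} {N b : nat} (N0 : (0 < N)%N) (b0 : (0 < b)%N).
Implicit Types c : 'I_N -> R.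

(** Complements of such sets are the subsets of [~: A] of size [N - b]. *)
Lemma card_supersets (A : {set 'I_N}) : (b <= N)%N ->
  #|[set D : {set 'I_N} | A \subset D & #|D| == b]| = 'C(N - #|A|, N - b).
Proof.
move=> bN.
rewrite -(card_imset _ (@finset.setC_inj 'I_N)) -[N in (N - #|A|)%N](card_ord N).
have -> : (#|'I_N| - #|A| = #|~: A|)%N by rewrite -[in LHS](cardsC A) addKn.
rewrite -cards_draws; apply: eq_card => D; rewrite !inE.
apply/imsetP/andP => [[E + ->]|[DA /eqP cD]].
  rewrite inE finset.setCS => /andP[-> /eqP <-].
  by rewrite [#|~: E|]cardsCs finset.setCK card_ord.
exists (~: D); rewrite ?finset.setCK// inE -finset.setCS finset.setCK DA /=.
by rewrite cardsCs finset.setCK cD card_ord subKn.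
Qed.

Lemma sum_subsets c : (b <= N)%N ->
  \sum_(D : {set 'I_N} | #|D| == b) \sum_(i in D) c i =
  'C(N.-1, N - b)%:R * \sum_i c i.
Proof.
move=> bN; rewrite (exchange_big_dep xpredT)//= mulr_sumr.
apply: eq_bigr => i _; rewrite sumr_const mulr_natl; congr (_ *+ _).
rewrite -subn1 -(cards1 i) -card_supersets//.
by apply: eq_card => D; rewrite !inE finset.sub1set andbC.
Qed.

(** Expand the square: a pair [(i, j)] is counted as often as there are sets
containing both, which depends only on whether [i = j].  If the [c i] add up to
0, the off-diagonal count contributes minus its value on the diagonal. *)
Lemma sum_subsets_sqr c : (b <= N)%N -> \sum_i c i = 0 ->
  \sum_(D : {set 'I_N} | #|D| == b) (\sum_(i in D) c i) ^+ 2 =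
  ('C(N.-1, N - b)%:R - 'C(N.-2, N - b)%:R) * \sum_i c i ^+ 2.
Proof.
move=> bN c0.
pose nn i j := #|[set D : {set 'I_N} | [set i; j]%SET \subset D & #|D| == b]|.
transitivity (\sum_i \sum_j (nn i j)%:R * (c i * c j)).
  under eq_bigr do rewrite expr2 big_distrlr/=.
  rewrite (exchange_big_dep xpredT)//=; apply: eq_bigr => i _.
  rewrite (exchange_big_dep xpredT)//=; apply: eq_bigr => j _.
  rewrite sumr_const mulr_natl; congr (_ *+ _).
  apply: eq_card => D; rewrite !inE.
  by rewrite finset.subUset !finset.sub1set unfold_in -andbA andbC.
rewrite mulr_sumr; apply: eq_bigr => i _.
transitivity ('C(N.-2, N - b)%:R * c i * (\sum_j c j)
   + ('C(N.-1, N - b)%:R - 'C(N.-2, N - b)%:R) * c i ^+ 2).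
  rewrite (bigD1 i)//= [X in _ * X + _](bigD1 i)//= mulrDr mulr_sumr.
  rewrite (eq_bigr (fun j => 'C(N.-2, N - b)%:R * c i * c j)) => [|j ji].
    rewrite /nn finset.setUid card_supersets// cards1 subn1; ring.
  by rewrite /nn card_supersets// cards2 eq_sym ji subn2 mulrA.
by rewrite c0 mulr0 add0r.
Qed.

(** With [bin_subset2], the inclusion probabilities of one index and of two
distinct indices, [b / N] and [b (b - 1) / (N (N - 1))], free of division. *)
Lemma bin_subset1 : (b <= N)%N ->
  N%:R * 'C(N.-1, N - b)%:R = b%:R * 'C(N, b)%:R :> R.
Proof.
move=> bN; rewrite -!natrM; congr (_%:R).
by rewrite mul_bin_down subKn// bin_sub.
Qed.

Lemma bin_subset2 : (b <= N)%N ->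
  (N%:R - 1) * 'C(N.-2, N - b)%:R = (b%:R - 1) * 'C(N.-1, N - b)%:R :> R.
Proof.
move=> bN; have e k : (0 < k)%N -> k%:R - 1 = k.-1%:R :> R.
  by move=> k0; rewrite -subn1 natrB.
rewrite !e// -!natrM; congr (_%:R); rewrite mul_bin_down; congr (_ * _)%N.
by rewrite -subn1 subnAC subKn// subn1.
Qed.

Lemma mean_centered c : mean (fun i => c i - mean c) = 0.
Proof.
rewrite (_ : (fun i => _) = fun i => 1 * c i + 0 * c i + - mean c); last first.
  by apply/funext => i; ring.
by rewrite mean_affine//; ring.
Qed.

Lemma sum_mean c : \sum_i c i = N%:R * mean c.
Proof. by rewrite /mean mulVKf// pnatr_eq0 -lt0n. Qed.

Lemma mean_subsets c : (b < N)%N ->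
  'C(N, b)%:R^-1 * \sum_(D : {set 'I_N} | #|D| == b)
     (b%:R^-1 * \sum_(i in D) c i) = mean c.
Proof.
move=> bN; rewrite -mulr_sumr sum_subsets ?(ltnW bN)// sum_mean.
have CN0 : 'C(N, b)%:R != 0 :> R by rewrite pnatr_eq0 -lt0n bin_gt0 ltnW.
have b1 : b%:R != 0 :> R by rewrite pnatr_eq0 -lt0n.
have E := bin_subset1 (ltnW bN).
rewrite [_ * (_ * mean c)]mulrA [_ * N%:R]mulrC E; field.
by rewrite CN0 b1.
Qed.

Lemma variance_subsets c : (b < N)%N ->
  btilde R WithoutReplacement N b *
  ('C(N, b)%:R^-1 * \sum_(D : {set 'I_N} | #|D| == b)
     (b%:R^-1 * \sum_(i in D) (c i - mean c)) ^+ 2) =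
  mean (fun i => (c i - mean c) ^+ 2).
Proof.
move=> bN.
have CN0 : 'C(N, b)%:R != 0 :> R by rewrite pnatr_eq0 -lt0n bin_gt0 ltnW.
have b1 : b%:R != 0 :> R by rewrite pnatr_eq0 -lt0n.
have N1 : N%:R != 0 :> R by rewrite pnatr_eq0 -lt0n.
have Nb : N%:R - b%:R != 0 :> R by rewrite subr_eq0 eqr_nat gtn_eqF.
have N2 : N%:R - 1 != 0 :> R.
  by rewrite subr_eq0 (eqr_nat _ N 1) gtn_eqF// (leq_ltn_trans b0 bN).
under eq_bigr do rewrite exprMn.
rewrite -mulr_sumr.
rewrite (@sum_subsets_sqr (fun i => c i - mean c)) ?(ltnW bN)//; last first.
  by rewrite sum_mean mean_centered mulr0.
rewrite sum_mean /btilde.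
have /(canRL (mulKf N1)) -> := bin_subset1 (ltnW bN).
have /(canRL (mulKf N2)) -> := bin_subset2 (ltnW bN).
have /(canRL (mulKf N1)) -> := bin_subset1 (ltnW bN).
by field; rewrite CN0 b1 N1 Nb N2.
Qed.

End uniform_moments.

Section sampling.
Context d (Omega : measurableType d) (R : realType) (Pr : probability Omega R).
Context (N b : nat) (N0 : (0 < N)%N) (b0 : (0 < b)%N).

(** A finite list of multisets that contains every batch, chosen independently of
the random element: all times share it. *)
Definition batch_support (sch : scheme) : seq {mset 'I_N}%mset :=
  undup match sch with
  | WithReplacement =>
      [seq seq_mset [seq (t : {ffun 'I_b -> 'I_N}) k | k <- enum 'I_b]
         | t <- enum {ffun 'I_b -> 'I_N}]
  | WithoutReplacement =>
      [seq seq_mset (enum (D : {set 'I_N})) | D <- enum {set 'I_N}]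
  end.

Definition sampled_law (sch : scheme) (I : Omega -> {mset 'I_N}%mset) :=
  let K := batch_support sch in
  [/\ forall w, I w \in K,
    forall J, measurable (I @^-1` [set J]),
    forall c : 'I_N -> R,
     \sum_(J <- K) pmass Pr I J * (b%:R^-1 * \sum_(i <- J) c i) = mean c &
    forall c : 'I_N -> R,
     btilde R sch N b * \sum_(J <- K) pmass Pr I J *
       (b%:R^-1 * \sum_(i <- J) c i - mean c) ^+ 2 =
     mean (fun i => (c i - mean c) ^+ 2)].

(** The hypothesis fixes the probabilities of the sets of size [b] only; they add
up to 1 already, so every other set has probability 0. *)
Lemma without_replacement_law (I : Omega -> {mset 'I_N}%mset) :
  uniform_without_replacement Pr b I ->
  sampled_law WithoutReplacement I.
Proof.
move=> [bN [S [mS PS IE]]].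
pose e (D : {set 'I_N}) : {mset 'I_N}%mset := seq_mset (enum D).
have mS1 D : measurable (S @^-1` [set D]) by exact: mS.
have -> : I = e \o S by apply/funext.
pose K := batch_support WithoutReplacement.
have eK D : e D \in K by rewrite mem_undup (map_f e)// mem_enum.
have pS (D : {set 'I_N}) : #|D| == b -> pmass Pr S D = 'C(N, b)%:R^-1.
  by move=> /eqP /PS; rewrite pmassE// => -[].
have CN0 : 'C(N, b)%:R != 0 :> R by rewrite pnatr_eq0 -lt0n bin_gt0 ltnW.
have pS0 (D : {set 'I_N}) : #|D| != b -> pmass Pr S D = 0.
  have := sum_pmass Pr mS1 (enum_uniq _) (fun w => mem_enum predT (S w)).
  rewrite big_enum/= (bigID (fun D : {set 'I_N} => #|D| == b))/=.
  rewrite (eq_bigr (fun=> 'C(N, b)%:R^-1))//.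
  rewrite sumr_const (_ : #|_| = 'C(N, b)); last first.
    rewrite -[in RHS](card_ord N) -card_draws.
    by apply: eq_card => D'; rewrite !inE.
  rewrite -[_ *+ _]mulr_natl divff// -[RHS]addr0 => /addrI h Db.
  by apply: (psumr_eq0P _ h) => // D' _; exact: pmass_ge0.
have sumS (phi : {set 'I_N} -> R) : \sum_D pmass Pr S D * phi D =
    'C(N, b)%:R^-1 * \sum_(D : {set 'I_N} | #|D| == b) phi D.
  rewrite (bigID (fun D : {set 'I_N} => #|D| == b))/= [X in _ + X]big1 ?addr0.
    by rewrite mulr_sumr; apply: eq_bigr => D /pS ->.
  by move=> D /pS0 ->; rewrite mul0r.
have eE (c : 'I_N -> R) D : \sum_(i <- e D) c i = \sum_(i in D) c i.
  by rewrite /e big_seq_mset big_enum.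
have uK : uniq K by exact: undup_uniq.
split => [|J|c|c].
- by move=> w; exact: eK.
- exact: measurable_fiber_comp.
- rewrite (@sum_pmass_comp _ _ _ Pr _ _ S e mS1 K
    (fun J : {mset 'I_N}%mset => b%:R^-1 * \sum_(i <- J) c i) uK eK).
  rewrite sumS -[RHS](mean_subsets N0 b0)//; congr (_ * _).
  by apply: eq_bigr => D _; rewrite eE.
- rewrite (@sum_pmass_comp _ _ _ Pr _ _ S e mS1 K
    (fun J : {mset 'I_N}%mset => (b%:R^-1 * \sum_(i <- J) c i - mean c) ^+ 2)
    uK eK).
  have b1 : b%:R != 0 :> R by rewrite pnatr_eq0 -lt0n.
  rewrite sumS -[RHS](variance_subsets N0 b0)//; congr (_ * (_ * _)).
  apply: eq_bigr => D /eqP Db; rewrite eE sumrB sumr_const Db.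
  by rewrite -[mean c *+ b]mulr_natl mulrBr mulKf.
Qed.

(** Only pairwise independence of the [b] draws is used: after centring, the
mixed terms of the squared sum vanish and [b] equal diagonal terms remain. *)
Lemma with_replacement_law (I : Omega -> {mset 'I_N}%mset) :
  uniform_with_replacement Pr b I ->
  sampled_law WithReplacement I.
Proof.
move=> [idx [mX ind unif IE]].
pose e (t : {ffun 'I_b -> 'I_N}) : {mset 'I_N}%mset :=
  seq_mset [seq t k | k <- enum 'I_b].
pose Y w : {ffun 'I_b -> 'I_N} := [ffun k => idx k w].
have IY : I = e \o Y.
  apply/funext => w; rewrite IE /e /=; congr seq_mset.
  by apply: eq_map => k; rewrite ffunE.
have mX1 k i : measurable (idx k @^-1` [set i]) by exact: mX.
have mY t : measurable (Y @^-1` [set t]).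
  rewrite (_ : _ @^-1` _ =
      \big[setI/setT]_(k <- enum 'I_b) (idx k @^-1` [set t k])).
    exact: bigsetI_measurable.
  rewrite -bigcap_seq; apply/seteqP; split => w /=.
    by move=> <- k _; rewrite ffunE.
  by move=> h; apply/ffunP => k; rewrite ffunE; apply: h; rewrite /= mem_enum.
have pX k i : pmass Pr (idx k) i = N%:R^-1 by rewrite /pmass unif.
have sum1 k (phi : 'I_N -> R) :
    \sum_t pmass Pr Y t * phi (t k) = N%:R^-1 * \sum_i phi i.
  pose ek (t : {ffun 'I_b -> 'I_N}) := t k.
  rewrite -(@sum_pmass_comp _ _ _ Pr _ _ Y ek mY (enum 'I_N)) ?enum_uniq//.
    rewrite big_enum mulr_sumr/=; apply: eq_bigr => i _.
    rewrite -(pX k i) (_ : ek \o Y = idx k)//.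
    by apply/funext => w; rewrite /ek /= ffunE.
  by move=> t; rewrite mem_enum.
have sum2 k k' (c : 'I_N -> R) : k != k' ->
    \sum_t pmass Pr Y t * (c (t k) * c (t k')) = (N%:R^-1 * \sum_i c i) ^+ 2.
  move=> kk'.
  pose ek (t : {ffun 'I_b -> 'I_N}) := (t k, t k').
  rewrite -(@sum_pmass_comp _ _ _ Pr _ _ Y ek mY (enum {: 'I_N * 'I_N})
    (fun x => c x.1 * c x.2)) ?enum_uniq//; last first.
    by move=> t; rewrite mem_enum.
  pose G i j := pmass Pr (ek \o Y) (i, j) * (c i * c j).
  rewrite big_enum/= (eq_bigr (fun x => G x.1 x.2)) => [|[]//].
  rewrite -(pair_bigA _ G)/= mulr_sumr expr2 big_distrlr/=.
  apply: eq_bigr => i _; apply: eq_bigr => j _.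
  rewrite mulrACA /G; congr (_ * _).
  rewrite /pmass (_ : _ @^-1` _ =
      idx k @^-1` [set i] `&` idx k' @^-1` [set j]); last first.
    apply/seteqP; split => w; rewrite /ek /Y /= !ffunE; first by case=> -> ->.
    by case=> -> ->.
  pose E l := if l == k then idx k @^-1` [set i] else idx k' @^-1` [set j].
  have := ind [fset k; k']%fset E _; rewrite bigcap_fset !big_fsetU1 ?inE//=.
  rewrite !big_seq_fset1 /E eqxx eq_sym (negPf kk') => ->.
    by rewrite !unif -EFinM.
  move=> l; rewrite !inE => /orP[] /eqP ->; rewrite /E ?eqxx.
    exact: sigma_of_fiber.
  by rewrite eq_sym (negPf kk'); exact: sigma_of_fiber.
have b1 : b%:R != 0 :> R by rewrite pnatr_eq0 -lt0n.
have eE (c : 'I_N -> R) (t : {ffun 'I_b -> 'I_N}) :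
    \sum_(i <- e t) c i = \sum_k c (t k).
  by rewrite /e big_seq_mset big_map big_enum.
pose K := batch_support WithReplacement.
have eK t : e t \in K by rewrite mem_undup (map_f e)// mem_enum.
have uK : uniq K by exact: undup_uniq.
rewrite IY; split => [|J|c|c].
- by move=> w; exact: eK.
- exact: measurable_fiber_comp.
- rewrite (@sum_pmass_comp _ _ _ Pr _ _ Y e mY K
    (fun J : {mset 'I_N}%mset => b%:R^-1 * \sum_(i <- J) c i) uK eK).
  under eq_bigr do rewrite eE mulrCA mulr_sumr.
  rewrite -mulr_sumr exchange_big/=.
  under eq_bigr do rewrite sum1.
  by rewrite sumr_const card_ord -[mean c *+ b]mulr_natl mulKf.
- rewrite (@sum_pmass_comp _ _ _ Pr _ _ Y e mY K
    (fun J : {mset 'I_N}%mset => (b%:R^-1 * \sum_(i <- J) c i - mean c) ^+ 2)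
    uK eK).
  have centre t : b%:R^-1 * \sum_(i <- e t) c i - mean c =
      b%:R^-1 * \sum_k (c (t k) - mean c).
    rewrite eE sumrB sumr_const card_ord -[mean c *+ b]mulr_natl.
    by rewrite mulrBr mulKf.
  under eq_bigr do rewrite centre exprMn mulrCA
    [(bigop _ _ _) ^+ 2]expr2 big_distrlr/= mulr_sumr.
  rewrite -mulr_sumr exchange_big/=.
  under eq_bigr do under eq_bigr do rewrite mulr_sumr.
  under eq_bigr do rewrite exchange_big/=.
  rewrite (eq_bigr (fun=> mean (fun i => (c i - mean c) ^+ 2))) => [|k _].
    rewrite sumr_const card_ord -[_ *+ b]mulr_natl /=.
    by field; rewrite b1.
  rewrite (bigD1 k)//= [X in _ + X]big1 ?addr0 => [|k' kk'].
    under eq_bigr do rewrite -expr2.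
    exact: sum1 k (fun i => (c i - mean c) ^+ 2).
  rewrite (sum2 k k' (fun i => c i - mean c)) 1?eq_sym//.
  by rewrite -/(mean _) mean_centered// expr0n.
Qed.

Lemma sampled_lawP sch (I : Omega -> {mset 'I_N}%mset) :
  sampled Pr sch b I -> sampled_law sch I.
Proof.
by case: sch; [exact: with_replacement_law|exact: without_replacement_law].
Qed.

End sampling.

(** * Averaging over the random initial state *)

Section independence.
Context d (Omega : measurableType d) (R : realType) (Pr : probability Omega R).

(** Both sides are integrals over [r] of tail probabilities, and for [r >= 0] the
event that [\1_E Z > r] is [E] intersected with [Z > r]. *)
Lemma expectation_indic_mul (E : set Omega) (Z : Omega -> R) :
  measurable E -> measurable_fun setT Z -> (forall w, 0 <= Z w) ->
  (forall r, Pr (E `&` Z @^-1` `]r, +oo[) = (Pr E * Pr (Z @^-1` `]r, +oo[))%E) ->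
  ('E_Pr[fun w => (\1_E w * Z w)%R] = Pr E * 'E_Pr[Z])%E.
Proof.
move=> mE mZ Z0 ind.
have mEZ : measurable_fun setT (fun w => \1_E w * Z w).
  by apply: measurable_funM => //; exact: measurable_indic.
pose X : {RV Pr >-> R} := mfun_Sub (mem_set mZ).
pose Y : {RV Pr >-> R} := mfun_Sub (mem_set mEZ).
have Y0 w : 0 <= Y w by rewrite /= mulr_ge0.
rewrite (ge0_expectation_ccdf (X := X))// (ge0_expectation_ccdf (X := Y))//.
rewrite -ge0_integralZl//; last first.
  by apply: measurable_funTS; exact: (ccdf_measurable X).
apply: eq_integral => r; rewrite inE/= in_itv/= andbT => r0.
rewrite /ccdf /distribution /pushforward/= -ind; congr (Pr _).
apply/seteqP; split => w /=; rewrite !in_itv/= !andbT indicE.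
  case: (boolP (w \in E)) => wE; first by rewrite mul1r inE in wE *.
  by rewrite mul0r ltNge r0.
by move=> [wE rZ]; rewrite mem_set// mul1r.
Qed.

Lemma expectation_sum_ge0 (T : Type) (s : seq T) (X : T -> Omega -> R) :
  (forall t, measurable_fun setT (X t)) -> (forall t w, 0 <= X t w) ->
  ('E_Pr[fun w => (\sum_(t <- s) X t w)%R] = \sum_(t <- s) 'E_Pr[X t])%E.
Proof.
move=> mX X0; rewrite unlock.
under eq_integral do rewrite -sumEFin.
rewrite ge0_integral_sum// => [t|t w _]; last by rewrite lee_fin.
exact/measurable_EFinP.
Qed.

Lemma expectationZl_ge0 (k : R) (X : Omega -> R) :
  measurable_fun setT X -> (forall w, 0 <= X w) -> 0 <= k ->
  ('E_Pr[fun w => (k * X w)%R] = k%:E * 'E_Pr[X])%E.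
Proof.
move=> mX X0 k0; rewrite unlock; under eq_integral do rewrite EFinM.
rewrite ge0_integralZl// => [|w _]; last by rewrite lee_fin.
exact/measurable_EFinP.
Qed.

Section batch_histories.
(* [J0] serves only as the default value of [nth]. *)
Context (S : choiceType) (J0 : S) (I : nat -> Omega -> S).
Context (mI : forall t J, measurable (I t @^-1` [set J])).
Context (Iind : mutually_independent Pr (fun t => sigma_of (discrete S) (I t))).

Fixpoint batch_history t w : seq S :=
  if t is t'.+1 then I t' w :: batch_history t' w else [::].

Lemma size_batch_history t w : size (batch_history t w) = t.
Proof. by elim: t => //= t ->. Qed.

Let p t J := pmass Pr (I t) J.

(** The reversal restores the chronological order: the batch drawn at time [k] is
entry [k] of [rev h]. *)
Lemma batch_history_preimage h : batch_history (size h) @^-1` [set h] =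
  \big[setI/setT]_(k <- iota 0 (size h)) (I k @^-1` [set nth J0 (rev h) k]).
Proof.
elim: h => [|J h IH].
  by rewrite /= big_nil; apply/seteqP; split.
rewrite /size -/(size _) -addn1 iotaD big_cat/= big_seq1 add0n.
rewrite rev_cons nth_rcons size_rev ltnn eqxx.
rewrite -bigcap_seq.
transitivity ((batch_history (size h) @^-1` [set h])
    `&` (I (size h) @^-1` [set J])).
  by rewrite addn1; apply/seteqP; split => w /= [-> ->].
rewrite IH -bigcap_seq; congr (_ `&` _).
apply: eq_bigcapr => k /=; rewrite mem_iota add0n => /andP[_ kh].
by rewrite nth_rcons size_rev kh.
Qed.

Lemma probability_batch_history h :
  Pr (batch_history (size h) @^-1` [set h]) = (weight p h)%:E.
Proof.
have -> : (weight p h)%:E =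
    (\prod_(k <- iota 0 (size h)) Pr (I k @^-1` [set nth J0 (rev h) k]))%E.
  elim: h => [|J h IH]; first by rewrite big_nil.
  rewrite [size _]/= -addn1 iotaD big_cat/= big_seq1 add0n EFinM IH.
  rewrite rev_cons nth_rcons size_rev ltnn eqxx -pmassE//; congr (_ * _)%E.
  rewrite !big_seq; apply: eq_bigr => k; rewrite mem_iota add0n => /andP[_ kh].
  by rewrite nth_rcons size_rev kh.
have H := @Iind [fset k in iota 0 (size h)]%fset
  (fun k => I k @^-1` [set nth J0 (rev h) k]) (fun k _ => sigma_of_fiber _ _).
rewrite bigcap_fset in H.
have pe : perm_eq [fset k in iota 0 (size h)]%fset (iota 0 (size h)).
  by apply: uniq_perm (fset_uniq _) (iota_uniq _ _) _ => k; rewrite inE.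
by rewrite batch_history_preimage -(perm_big _ pe) -(perm_big _ pe).
Qed.

Lemma measurable_batch_history t h : measurable (batch_history t @^-1` [set h]).
Proof.
have [<-|th] := eqVneq (size h) t.
  by rewrite batch_history_preimage; exact: bigsetI_measurable.
rewrite (_ : _ @^-1` _ = set0)//; apply/seteqP; split => // w /= hw.
by move: th; rewrite -hw size_batch_history eqxx.
Qed.

Lemma generated_batch_history h :
  <<s \bigcup_t sigma_of (discrete S) (I t) >>
    (batch_history (size h) @^-1` [set h]).
Proof.
rewrite batch_history_preimage.
pose T := g_sigma_algebraType (\bigcup_t sigma_of (discrete S) (I t)).
rewrite -[<<s _ >>]/(@measurable _ T).
apply: (@bigsetI_measurable _ T) => k _.
by apply: sub_sigma_algebra; exists k => //; exact: sigma_of_fiber.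
Qed.

Section initial_state.
Context (n : nat) (x0 : Omega -> 'cV[R]_n).
Context (mx0 : random_element (borel_cV R n) x0).
Context (x0ind : independent Pr (sigma_of (borel_cV R n) x0)
     <<s \bigcup_t sigma_of (discrete S) (I t) >>).

Definition borel_col := g_sigma_algebraType (@open 'cV[R]_n).

Lemma measurable_initial (phi : borel_col -> R) :
  measurable_fun setT phi -> measurable_fun setT (phi \o x0).
Proof.
move=> mphi _ U mU; rewrite setTI comp_preimage; apply: mx0.
by have := mphi measurableT U mU; rewrite setTI.
Qed.

Lemma uniq_histories (K : seq S) t : uniq K -> uniq (histories K t).
Proof.
move=> uK; elim: t => //= t IH; apply: allpairs_uniq => //.
by move=> [h J] [h' J'] _ _ [-> ->].
Qed.

Lemma mem_histories (K : seq S) t w :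
  (forall t w, I t w \in K) -> batch_history t w \in histories K t.
Proof.
move=> IK; elim: t => //= t IH.
by apply/allpairsP; exists (batch_history t w, I t w); split => //=; exact: IK.
Qed.

(** Split according to the value of the history; the event that it equals [h] is
independent of [x0] and has probability [weight p h]. *)
Lemma expectation_history (K : seq S) (phi : seq S -> borel_col -> R) t :
  uniq K -> (forall t w, I t w \in K) ->
  (forall h, measurable_fun setT (phi h)) -> (forall h x, 0 <= phi h x) ->
  ('E_Pr[fun w => phi (batch_history t w) (x0 w)] =
  'E_Pr[fun w => (\sum_(h <- histories K t) weight p h * phi h (x0 w))%R])%E.
Proof.
move=> uK IK mphi phi0.
have mZ h : measurable_fun setT (phi h \o x0) by exact: measurable_initial.
have w0 h : 0 <= weight p h.
  by elim: h => //= J h IH; rewrite mulr_ge0// pmass_ge0.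
pose E h := batch_history t @^-1` [set h].
have mE h : measurable (E h) by exact: measurable_batch_history.
have -> : (fun w => phi (batch_history t w) (x0 w)) =
    (fun w => \sum_(h <- histories K t) \1_(E h) w * (phi h \o x0) w).
  apply/funext => w.
  rewrite (bigD1_seq (batch_history t w)) ?uniq_histories//=; last first.
    exact: mem_histories.
  rewrite indicE mem_set// mul1r big1 ?addr0// => h hw.
  by rewrite indicE memNset ?mul0r// /E /= => /esym/eqP; rewrite (negPf hw).
rewrite expectation_sum_ge0; last 2 first.
- by move=> h; apply: measurable_funM => //; exact: measurable_indic.
- by move=> h w; rewrite mulr_ge0// /= phi0.
rewrite expectation_sum_ge0; last 2 first.
- by move=> h; apply: measurable_funM => //; exact: mZ.
- by move=> h w; rewrite mulr_ge0.
rewrite !big_seq; apply: eq_bigr => h ht.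
rewrite expectation_indic_mul//; last 2 first.
- by move=> w; exact: phi0.
- move=> r; rewrite setIC [RHS]muleC; apply: x0ind; last first.
    by rewrite /E -(size_histories ht); exact: generated_batch_history.
  exists (phi h @^-1` `]r, +oo[); last by rewrite setTI comp_preimage.
  have := mphi h measurableT `]r, +oo[%classic.
  by rewrite setTI; apply; exact: measurable_itv.
rewrite /E -(size_histories ht) probability_batch_history.
by rewrite -expectationZl_ge0// => w; exact: phi0.
Qed.

End initial_state.

End batch_histories.

End independence.

Section measurable_states.
Context {R : realType} {n s : nat} {T : eqType}.
Context (A : 'M[R]_n) (B : 'cV[R]_n) (C : 'rV[R]_n) (G : T -> R -> R).

Lemma measurable_coord i :
  measurable_fun setT (fun x : borel_col R n => (x : 'cV[R]_n) i 0).
Proof.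
apply: (measurability _ (RGenOpens.measurableE R)).
move=> _ [_ [a [b ->]] <-]; rewrite setTI; apply: sub_sigma_algebra.
have := @coord_continuous R n 1 i 0 => /continuousP; apply.
exact: interval_open.
Qed.

Lemma measurable_bform (P : 'M[R]_(n + s)) : measurable_fun setT
  (fun x : borel_col R n =>
     bform P (col_mx (x : 'cV[R]_n) 0) (col_mx (x : 'cV[R]_n) 0)).
Proof.
under eq_fun do rewrite bformE.
apply: measurable_sum => i; apply: measurable_sum => j.
have mc k : measurable_fun setT
    (fun x : borel_col R n => col_mx (x : 'cV[R]_n) (0 : 'cV[R]_s) k 0).
  case: (split_ordP k) => l ->.
    under eq_fun do rewrite col_mxEu; exact: measurable_coord.
  by under eq_fun do rewrite col_mxEd mxE; exact: measurable_cst.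
by apply: measurable_funM => //; apply: measurable_funM.
Qed.

Context (mG : forall J, measurable_fun setT (G J)).

Lemma measurable_state h i :
  measurable_fun setT (fun x : borel_col R n => state A B C G x h i 0).
Proof.
elim: h i => [|J h IH] i /=; first exact: measurable_coord.
under eq_fun => x.
  rewrite mxE [X in X + _]mxE [X in _ + X]mxE big_ord1 [X in _ * X]mxE eqxx.
  rewrite mulr1n.
  rewrite [X in G J X]mxE.
  over.
apply: measurable_funD.
  by apply: measurable_sum => j; apply: measurable_funM.
apply: measurable_funM => //; apply: measurableT_comp => //.
by apply: measurable_sum => j; apply: measurable_funM.
Qed.

Lemma measurable_query h :
  measurable_fun setT (fun x : borel_col R n => query A B C G x h).
Proof.
rewrite /query; under eq_fun do rewrite mxE.
apply: measurable_sum => j; apply: measurable_funM => //.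
exact: measurable_state.
Qed.

End measurable_states.

Lemma measurable_batch_grad (R : realType) N b (f : 'I_N -> R -> R) J :
  (forall i, continuous (derive1 (f i))) ->
  measurable_fun setT (batch_grad b f J).
Proof.
move=> cf; apply: measurable_funM => //; apply: measurable_sum => i.
exact: continuous_measurable_fun.
Qed.

Theorem theorem12 (R : realType)
  (d : measure_display) (Omega : measurableType d) (Pr : probability Omega R)
  (m l : R) (hm : 0 < m) (hml : m <= l)
  (N : nat) (hN : (0 < N)%N)
  (f : 'I_N -> R -> R) (hf : forall i, in_S m l (f i))
  (hgrad0 : derive1 (fun z : R => N%:R^-1 * \sum_(i < N) f i z) 0 = 0)
  (hsigma : N%:R^-1 * \sum_(i < N) `|derive1 (f i) 0| ^+ 2 = 0)
  (sch : scheme) (b : nat) (hb : (0 < b)%N)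
  (I : nat -> Omega -> {mset 'I_N}%mset)
  (hI : forall t, sampled Pr sch b (I t))
  (hIind : mutually_independent Pr
     (fun t => sigma_of (discrete {mset 'I_N}%mset) (I t)))
  (n s : nat) (A : 'M[R]_n) (B : 'cV[R]_n) (C : 'rV[R]_n)
  (rho : R) (hrho0 : 0 < rho) (hrho1 : rho <= 1)
  (x : nat -> Omega -> 'cV[R]_n) (z w : nat -> Omega -> R)
  (hx0 : random_element (borel_cV R n) (x 0%N))
  (hx0sq : ('E_Pr[fun om => (enorm (x 0%N om) ^+ 2)%R] < +oo)%E)
  (hx0ind : independent Pr (sigma_of (borel_cV R n) (x 0%N))
     <<s \bigcup_t sigma_of (discrete {mset 'I_N}%mset) (I t) >>)
  (hx : forall t om, x t.+1 om = A *m x t om + B *m (w t om)%:M)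
  (hz : forall t om, z t om = (C *m x t om) 0 0)
  (hw : forall t om, w t om = batch_grad b f (I t om) (z t om))
  (P : 'M[R]_(n + s)) (nu : R) (lam : 'I_s.+1 -> R)
  (hP : posdef P)
  (hLMI : negdef (lmi_mx lam m l rho A B C P))
  (hB2 : 0 > ((calB2 s rho B)^T *m P *m calB2 s rho B) 0 0
             - 2 * btilde R sch N b * nu)
  (hlam : forall j : 'I_s.+1, (0 < j)%N -> lam j <= 0)
  (hnu : nu = \sum_(j < s.+1) rho ^- j * lam j) (hnu0 : 0 <= nu) :
  forall t : nat,
    ((lambda_min P)%:E * 'E_Pr[fun om => (`|z t om| ^+ 2)%R]
     <= (enorm C^T ^+ 2 * rho ^+ (2 * t))%:E
        * 'E_Pr[fun om => (((col_mx (x 0%N om) 0)^T *m P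
                             *m col_mx (x 0%N om) 0) 0 0)%R])%E.
Proof.
move=> t.
pose f' i := derive1 (f i).
pose F v := mean (fun i => f i v).
pose g v := mean (fun i => f' i v).
pose G (J : {mset 'I_N}%mset) v := batch_grad b f J v.
pose K := batch_support N b sch.
pose p t J := pmass Pr (I t) J.
have law t' : sampled_law Pr b sch (I t') by exact: sampled_lawP.
have IK t' om : I t' om \in K by have [] := law t'.
have mI t' J : measurable (I t' @^-1` [set J]) by have [] := law t'.
have uK : uniq K by exact: undup_uniq.
have tbi i : tangent_bounds m l (f i) (f' i) by exact: in_S_tangent_bounds.
have tb : tangent_bounds m l F g by exact: mean_tangent_bounds.
have f'0 i : f' i 0 = 0.
  move/eqP: hsigma; rewrite mulf_eq0 invr_eq0 pnatr_eq0 -leqn0 leqNgt hN/=.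
  rewrite psumr_eq0 => [/allP/(_ i)|j _]; last by rewrite sqr_ge0.
  by rewrite mem_index_enum/= sqrf_eq0 normr_eq0 => /(_ isT)/eqP.
have g0 : g 0 = 0 by rewrite /g /mean big1 ?mulr0.
have unb t' : unbiased_law m l (btilde R sch N b) g G K (p t').
  have [_ _ mean_law var_law] := law t'; split.
  - by move=> J; exact: pmass_ge0.
  - exact: sum_pmass.
  - by move=> v; exact: mean_law (f'^~ v).
  - move=> v; rewrite (var_law (f'^~ v)).
    exact: (variance_le_supply v hN tbi hml f'0).
have noise : bform P (calB2 s rho B) (calB2 s rho B) <=
    2 * btilde R sch N b * nu.
  by rewrite -subr_le0 ltW.
have mG J : measurable_fun setT (G J).
  apply: measurable_batch_grad => i.
  exact: tangent_bounds_continuous (tbi i) hml.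
have xE t' om : x t' om = state A B C G (x 0%N om) (batch_history I t' om).
  by elim: t' => //= t' <-; rewrite hx hw hz.
have zE om : `|z t om| ^+ 2 =
    query A B C G (x 0%N om) (batch_history I t om) ^+ 2.
  by rewrite real_normK ?num_real// hz xE.
under [in leLHS]eq_fun do rewrite zE.
pose phi h (v : borel_col R n) : R := query A B C G v h ^+ 2.
have mphi h : measurable_fun setT (phi h).
  by apply: measurable_funX; exact: measurable_query.
have phi0 h v : 0 <= phi h v by exact: sqr_ge0.
rewrite (expectation_history mset0 mI hIind hx0 hx0ind t uK IK mphi phi0).
pose V (v : borel_col R n) :=
  bform P (col_mx (v : 'cV[R]_n) 0) (col_mx (v : 'cV[R]_n) 0).
have mV : measurable_fun setT (V \o x 0%N).
  by apply: (measurable_initial hx0); exact: measurable_bform.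
have w0 h : 0 <= weight p h by exact: weight_ge0 unb h.
have mS : measurable_fun setT
    (fun om => \sum_(h <- histories K t) weight p h * phi h (x 0%N om)).
  apply: measurable_sum => h; apply: measurable_funM => //.
  exact: (measurable_initial hx0 (mphi h)).
have S0 om : 0 <= \sum_(h <- histories K t) weight p h * phi h (x 0%N om).
  by rewrite sumr_ge0// => h _; rewrite mulr_ge0.
have V0 om : 0 <= (V \o x 0%N) om by exact: posdef_bform_ge0.
have c0 : 0 <= enorm C^T ^+ 2 * rho ^+ (2 * t).
  by rewrite mulr_ge0 ?sqr_ge0// exprn_ge0// ltW.
rewrite -[X in (_ <= _ * 'E_Pr[X])%E]/(V \o x 0%N).
rewrite -!expectationZl_ge0 ?lambda_min_ge0//.
apply: expectation_le => //.
- by apply: measurable_funM.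
- by apply: measurable_funM.
- by move=> om; rewrite mulr_ge0 ?lambda_min_ge0.
- by move=> om; rewrite mulr_ge0.
apply: aeW => om /=.
exact: (mean_query_le (x 0%N om) hrho0 tb hml g0 hrho1 hlam hP hLMI hnu hnu0
  noise unb t).
Qed.
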